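(* Let $g_0=dr^2+f(r)^2d\theta^2$ be a smooth rotationally symmetric metric on $M=\mathbb{S}^1\times[-\rho,\rho]$ with $A_{g_0}(M)=1$, $R_{g_0}\ge0$, $k_{g_0}\le0$, which is symmetric under the reflection $r\mapsto -r$ and whose scalar curvature is decreasing from the middle, i.e. $R_{g_0}$, as a function of $r$, is nonincreasing in $|r|$. Then along the normalised flow $g(t)$ starting at $g_0$ there is a sequence $t_k\to\infty$ with $\max_M R(\cdot,t_k)\to0$.
   Context: The middle parallel is $\mathbb{S}^1\times\{0\}$. $R$ denotes scalar curvature, $k_g$ the geodesic curvature of $\partial M$ w.r.t. the outward normal. The unnormalised flow solves $\partial_{\tilde t}\tilde g=-\tilde R\tilde g$, $k_{\tilde g}=k_{g_0}$ on $\partial M$, $\tilde g(0)=g_0$. The normalised flow is $g=\phi\tilde g$ with $\phi(\tilde t)$ chosen so that $A_g(M)=1$, reparametrised by $t=\int_0^{\tilde t}\phi(\tau)d\tau$; it solves $\partial_t g=(r-R)g$, $k_g=k_{g_0}/\sqrt{\phi}$ on $\partial M$, $g(0)=g_0$, with $r=\int_M R\,dA_g$; it exists for all time. Rotational symmetry, reflection symmetry and the property of curvature decreasing from the middle are preserved by the flow. *)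

(* Defs.v *)
From Stdlib Require Export Reals.
Open Scope R_scope.

Definition inI (rho r : R) : Prop := - rho <= r <= rho.

(* A smooth function R -> R, given with the family of all its derivatives:
   df 0 = f and df (S n) is the derivative of df n everywhere. *)
Definition smooth1 (df : nat -> R -> R) : Prop :=
  forall n x, derivable_pt_lim (df n) x (df (S n) x).

Definition cont2 (F : R -> R -> R) (t r : R) : Prop :=
  forall eps, 0 < eps -> exists delta, 0 < delta /\
    forall s x, Rabs (s - t) < delta -> Rabs (x - r) < delta ->
      Rabs (F s x - F t r) < eps.

Definition smooth2_pos (Du : nat -> nat -> R -> R -> R) : Prop :=
  forall i j t r, 0 < t ->
    cont2 (Du i j) t r /\
    derivable_pt_lim (fun s => Du i j s r) t (Du (S i) j t r) /\
    derivable_pt_lim (fun x => Du i j t x) r (Du i (S j) t r).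

Definition is_integral (h : R -> R) (a b c : R) : Prop :=
  exists F : R -> R,
    (forall x, a <= x <= b -> derivable_pt_lim F x (h x)) /\ F b - F a = c.

(* Scalar curvature R = 2K of the rotationally symmetric metric
   e^{2w} (dr^2 + f(r)^2 dtheta^2) at radius r, where w = w(r) is radial,
   f1 = f', f2 = f'', wr = w', wrr = w'':
   K = e^{-2w} (K_0 - Delta_{g0} w),  K_0 = -f''/f,
   Delta_{g0} w = w'' + (f'/f) w'. *)
Definition scal_conf (f f1 f2 : R -> R) (w wr wrr : R) (r : R) : R :=
  exp (-2 * w) * (-2 * f2 r / f r - 2 * (wrr + f1 r / f r * wr)).

(* Geodesic curvature, w.r.t. the outward normal, of the boundary circle
   {r = x} for the metric e^{2w}(dr^2 + f^2 dtheta^2), where the outward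
   normal of g0 is sgn * d/dr (sgn = 1 at x = rho, sgn = -1 at x = -rho):
   k = e^{-w} (k_{g0} + d_nu w),  k_{g0} = sgn * f'(x)/f(x). *)
Definition geod_conf (sgn : R) (f f1 : R -> R) (w wr : R) (x : R) : R :=
  exp (- w) * (sgn * (f1 x / f x) + sgn * wr).

(* Main.v *)
Require Import Defs.
From Stdlib Require Import Reals Ranalysis5 Lra Psatz Classical ClassicalEpsilon.
From Coquelicot Require Import Coquelicot.
Open Scope R_scope.

(* Let g~ = e^{2v} g0 be the unnormalised flow.  It does not increase v, because
   v = 0 is a supersolution; comparing v(t + tau) with v(t) gives R >= 0, and a
   two-point maximum principle for v(t + tau, x) - v(t, x) shows that R(t, .)
   stays decreasing from the middle.  Both arguments use only the continuity of v
   at t = 0, so no compatibility conditions at the corners are needed.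

   In the normalised flow, R >= 0 makes the radius of the circles of latitude
   decrease from the middle, so area 1 bounds it above at the boundary and below
   in the middle.  By Gauss-Bonnet r <= C / sqrt phi; since phi' = r phi, phi grows
   at most quadratically.  Finally (ln phi - 2 u(., 0))' = R(., 0) = max R, where
   the left-hand side grows at most logarithmically, so max R cannot stay above a
   positive constant.  If the boundary is totally geodesic then g0 is flat and the
   flow is constant. *)

(** * Maximum principles *)

(** Nothing is assumed about derivatives of [u] at [t = 0], so [R(t, .)] is not known to tend to the
    curvature of g0, and a maximum principle for the evolution equation of [R] would lack an initial
    value. Each statement about [R] is therefore proved for a finite time difference of [v], which
    is continuous down to [t = 0], and then differentiated: [v_t] is minus the Gauss curvature of
    g~. The unnormalised flow is preferred because its equation is local in time and its boundary
    condition, outward derivative of [v] equal to [k0 * (exp v - 1)], has a right-hand side strictly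
    decreasing in [v] when [k0 < 0]. This sign makes comparison strict at the boundary; it
    degenerates for [k0 = 0], which is why that case is treated apart. The two-point argument needs
    a bound [- B <= v_t]. At positive times it comes from smoothness; near [t = 0] it comes from
    scaling: if [v] solves the equation, so does [v(e^{2a} t) - a]. *)

Lemma derive_at_left_max (F : R -> R) (a x l : R) :
  derivable_pt_lim F x l -> a < x -> (forall y, a <= y <= x -> F y <= F x) -> 0 <= l.
Proof.
intros D ax H.
destruct (Rle_or_lt 0 l) as [h|h]; [exact h|exfalso].
destruct (D (- l)) as [del Hd]; [lra|].
pose proof (cond_pos del) as dp.
set (s := Rmin (del / 2) (x - a)).
assert (s1 : 0 < s) by (unfold s; apply Rmin_pos; lra).
assert (s2 : s <= del / 2) by apply Rmin_l.
assert (s3 : s <= x - a) by apply Rmin_r.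
assert (q := Hd (- s) ltac:(lra) ltac:(rewrite Rabs_left; lra)).
apply Rabs_def2 in q.
assert (q2 := H (x + - s) ltac:(lra)).
assert (0 <= (F (x + - s) - F x) / - s).
{ replace ((F (x + - s) - F x) / - s) with ((F x - F (x + - s)) * / s) by (field; lra).
  apply Rmult_le_pos; [lra|]. left; apply Rinv_0_lt_compat; lra. }
lra.
Qed.

Lemma derive_at_right_max (F : R -> R) (b x l : R) :
  derivable_pt_lim F x l -> x < b -> (forall y, x <= y <= b -> F y <= F x) -> l <= 0.
Proof.
intros D xb H.
destruct (Rle_or_lt l 0) as [h|h]; [exact h|exfalso].
destruct (D l h) as [del Hd].
pose proof (cond_pos del) as dp.
set (s := Rmin (del / 2) (b - x)).
assert (s1 : 0 < s) by (unfold s; apply Rmin_pos; lra).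
assert (s2 : s <= del / 2) by apply Rmin_l.
assert (s3 : s <= b - x) by apply Rmin_r.
assert (q := Hd s ltac:(lra) ltac:(rewrite Rabs_pos_eq; lra)).
apply Rabs_def2 in q.
assert (q2 := H (x + s) ltac:(lra)).
assert ((F (x + s) - F x) / s <= 0).
{ replace ((F (x + s) - F x) / s) with (- ((F x - F (x + s)) * / s)) by (field; lra).
  enough (0 <= (F x - F (x + s)) * / s) by lra.
  apply Rmult_le_pos; [lra|]. left; apply Rinv_0_lt_compat; lra. }
lra.
Qed.

Lemma derive_at_inner_max (F F1 : R -> R) (a b x l : R) :
  (forall y, a <= y <= b -> derivable_pt_lim F y (F1 y)) ->
  derivable_pt_lim F1 x l -> a < x < b ->
  (forall y, a <= y <= b -> F y <= F x) -> F1 x = 0 /\ l <= 0.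
Proof.
intros D D2 xab H.
assert (z : F1 x = 0).
{ apply Rle_antisym.
  - apply (derive_at_right_max F b x); [apply D; lra|lra|intros; apply H; lra].
  - apply (derive_at_left_max F a x); [apply D; lra|lra|intros; apply H; lra]. }
split; [exact z|].
destruct (Rle_or_lt l 0) as [h|h]; [exact h|exfalso].
destruct (D2 l h) as [del Hd].
pose proof (cond_pos del) as dp.
set (s := Rmin (del / 2) (b - x)).
assert (s1 : 0 < s) by (unfold s; apply Rmin_pos; lra).
assert (s2 : s <= del / 2) by apply Rmin_l.
assert (s3 : s <= b - x) by apply Rmin_r.
destruct (MVT_cor2 F F1 x (x + s)) as [c [e hc]]; [lra|intros; apply D; lra|].
assert (q := Hd (c - x) ltac:(lra) ltac:(rewrite Rabs_pos_eq; lra)).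
apply Rabs_def2 in q.
replace (x + (c - x)) with c in q by ring. rewrite z in q.
assert (0 < F1 c).
{ replace (F1 c) with ((F1 c - 0) / (c - x) * (c - x)) by (field; lra).
  apply Rmult_lt_0_compat; lra. }
assert (q2 := H (x + s) ltac:(lra)).
nra.
Qed.

(** The symmetries are known only on [[-rho, rho]], while the derivatives are two-sided on the line.
    At an endpoint one side already determines the derivative. *)
Lemma derive_unique_left (F G : R -> R) (a x l m : R) :
  derivable_pt_lim F x l -> derivable_pt_lim G x m -> a < x ->
  (forall y, a <= y <= x -> F y = G y) -> l = m.
Proof.
intros DF DG ax H.
assert (p := derivable_pt_lim_minus _ _ _ _ _ DF DG).
assert (q := derivable_pt_lim_minus _ _ _ _ _ DG DF).
assert (h := derive_at_left_max _ a x _ p ax).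
assert (k := derive_at_left_max _ a x _ q ax).
unfold minus_fct in *.
enough (0 <= l - m /\ 0 <= m - l) by lra.
split; [apply h|apply k]; intros y hy; rewrite (H y hy), (H x); lra.
Qed.

Lemma derive_unique_right (F G : R -> R) (b x l m : R) :
  derivable_pt_lim F x l -> derivable_pt_lim G x m -> x < b ->
  (forall y, x <= y <= b -> F y = G y) -> l = m.
Proof.
intros DF DG ax H.
assert (p := derivable_pt_lim_minus _ _ _ _ _ DF DG).
assert (q := derivable_pt_lim_minus _ _ _ _ _ DG DF).
assert (h := derive_at_right_max _ b x _ p ax).
assert (k := derive_at_right_max _ b x _ q ax).
unfold minus_fct in *.
enough (l - m <= 0 /\ m - l <= 0) by lra.
split; [apply h|apply k]; intros y hy; rewrite (H y hy), (H x); lra.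
Qed.

Lemma derivable_pt_lim_comp_opp (F : R -> R) (x l : R) :
  derivable_pt_lim F (- x) l -> derivable_pt_lim (fun y => F (- y)) x (- l).
Proof.
intros H. apply is_derive_Reals. apply is_derive_Reals in H.
replace (- l) with (scal (-1) l) by (unfold scal; simpl; unfold mult; simpl; ring).
apply (is_derive_comp F Ropp x l (-1)); [exact H|]. auto_derive; [exact I|ring].
Qed.

Lemma derivable_pt_lim_continuous (F : R -> R) (x l : R) :
  derivable_pt_lim F x l -> forall eps, 0 < eps -> exists del, 0 < del /\
    forall y, Rabs (y - x) < del -> Rabs (F y - F x) < eps.
Proof.
intros D eps he.
assert (c : continuity_pt F x) by (apply derivable_continuous_pt; exists l; exact D).
destruct (c eps he) as [del [hd H]]. exists del; split; [exact hd|].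
intros y hy. destruct (Req_dec x y) as [<-|ne].
- rewrite Rminus_diag, Rabs_R0; exact he.
- apply H. split; [split; [exact I|exact ne]|exact hy].
Qed.

(** * The first touching time on a compact set *)

Definition cont_on (T : R) (P : R -> R -> Prop) (d : R -> R -> R -> R) : Prop :=
  forall t x y, 0 <= t <= T -> P x y -> forall eps, 0 < eps ->
    exists del, 0 < del /\ forall s x' y', 0 <= s <= T -> P x' y' ->
      Rabs (s - t) < del -> Rabs (x' - x) < del -> Rabs (y' - y) < del ->
      Rabs (d s x' y' - d t x y) < eps.

(** Tube lemma: [s] is an offset from a fixed time, and compactness of the square makes the
    neighbourhood of [s = 0] uniform in [(x, y)]. *)
Lemma tube_2d (a : R) (A : R -> R -> R -> Prop) :
  (forall x y, exists del, 0 < del /\ forall s x' y',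
      Rabs s < del -> Rabs (x' - x) < del -> Rabs (y' - y) < del -> A s x' y') ->
  exists del, 0 < del /\ forall s x y, Rabs s < del ->
    - a <= x <= a -> - a <= y <= a -> A s x y.
Proof.
intros H.
assert (H' : forall x y, exists del : posreal, forall s x' y',
      Rabs s < del -> Rabs (x' - x) < del -> Rabs (y' - y) < del -> A s x' y').
{ intros x y; destruct (H x y) as [e [he h]]; exists (mkposreal e he); exact h. }
set (del := fun x y => proj1_sig (constructive_indefinite_description _ (H' x y))).
assert (Hdel : forall x y s x' y',
      Rabs s < del x y -> Rabs (x' - x) < del x y -> Rabs (y' - y) < del x y -> A s x' y')
  by (intros x y; exact (proj2_sig (constructive_indefinite_description _ (H' x y)))).
destruct (compactness_value_2d (- a) a (- a) a del) as [e he].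
exists e; split; [apply cond_pos|].
intros s x y hs hx hy.
destruct (NNPP _ (he x y hx hy)) as [p [q [_ [_ [h1 [h2 h3]]]]]].
apply (Hdel p q); lra.
Qed.

(** The first two hypotheses make [P] compact. Let [ts] be the supremum of the times up to which [d]
    is negative. A zero of [d] at time [ts] is excluded by the touching hypothesis; without one,
    compactness carries negativity beyond [ts]. *)
Lemma first_touching (T a : R) (P : R -> R -> Prop) (d : R -> R -> R -> R) :
  (forall x y, P x y -> - a <= x <= a /\ - a <= y <= a) ->
  (forall x y, ~ P x y -> exists del, 0 < del /\
      forall x' y', Rabs (x' - x) < del -> Rabs (y' - y) < del -> ~ P x' y') ->
  cont_on T P d ->
  (forall x y, P x y -> d 0 x y < 0) ->
  (forall t x y, 0 < t <= T -> P x y -> d t x y = 0 ->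
     (forall s x' y', 0 <= s <= t -> P x' y' -> d s x' y' <= 0) -> False) ->
  forall t x y, 0 <= t <= T -> P x y -> d t x y < 0.
Proof.
intros Hbd Hcl Hc H0 Htouch t1 x1 y1 ht1 hP1.
set (G := fun t => 0 <= t <= T /\ forall s x y, 0 <= s <= t -> P x y -> d s x y < 0).
assert (G0 : G 0).
{ split; [lra|]. intros s x y hs hp. replace s with 0 by lra. auto. }
destruct (completeness G) as [ts [ub lub]].
{ exists T. intros t [h _]; lra. }
{ exists 0; exact G0. }
assert (ts0 : 0 <= ts) by (apply ub; exact G0).
assert (tsT : ts <= T) by (apply lub; intros t [h _]; lra).
assert (below : forall s x y, 0 <= s < ts -> P x y -> d s x y < 0).
{ intros s x y hs hp.
  destruct (classic (exists t, G t /\ s < t)) as [[t [[_ g] st]]|n].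
  - apply g; [lra|exact hp].
  - exfalso. enough (ts <= s) by lra. apply lub. intros t gt.
    destruct (Rle_or_lt t s) as [h|h]; [exact h|exfalso; apply n; exists t; auto]. }
assert (le0 : forall x y, P x y -> d ts x y <= 0).
{ intros x y hp. destruct (Rle_or_lt (d ts x y) 0) as [h|h]; [exact h|exfalso].
  destruct (Req_dec ts 0) as [e|ne]; [rewrite e in h; specialize (H0 x y hp); lra|].
  destruct (Hc ts x y ltac:(lra) hp _ h) as [del [dp hd]].
  set (s := Rmax 0 (ts - del / 2)).
  assert (s1 : 0 <= s) by apply Rmax_l.
  assert (s2 : ts - del / 2 <= s) by apply Rmax_r.
  assert (s3 : s < ts) by (unfold s; apply Rmax_lub_lt; lra).
  assert (q := hd s x y ltac:(lra) hp).
  rewrite !Rminus_diag, !Rabs_R0 in q.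
  assert (q2 := q ltac:(rewrite Rabs_left; lra) dp dp).
  apply Rabs_def2 in q2. specialize (below s x y ltac:(lra) hp). lra. }
assert (lt0 : forall x y, P x y -> d ts x y < 0).
{ intros x y hp. destruct (Req_dec (d ts x y) 0) as [e|ne];
    [exfalso|specialize (le0 x y hp); lra].
  destruct (Req_dec ts 0) as [e0|ne0]; [rewrite e0 in e; specialize (H0 x y hp); lra|].
  apply (Htouch ts x y); [lra|exact hp|exact e|].
  intros s x' y' hs hp'. destruct (Req_dec s ts) as [->|ns]; [auto|].
  left; apply below; [lra|exact hp']. }
destruct (tube_2d a (fun s x y => 0 <= ts + s <= T -> P x y -> d (ts + s) x y < 0))
  as [del [dp hd]].
{ intros x y. destruct (classic (P x y)) as [hp|np].
  - destruct (Hc ts x y ltac:(lra) hp (- d ts x y)) as [del [dp hd]].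
    { specialize (lt0 x y hp); lra. }
    exists del; split; [exact dp|]. intros s x' y' hs hx hy hT hp'.
    specialize (hd (ts + s) x' y' hT hp').
    replace (ts + s - ts) with s in hd by ring.
    specialize (hd hs hx hy). apply Rabs_def2 in hd. lra.
  - destruct (Hcl x y np) as [del [dp hd]]. exists del; split; [exact dp|].
    intros s x' y' _ hx hy _ hp'. exfalso; exact (hd x' y' hx hy hp'). }
assert (next : forall s, 0 <= s <= T -> s < ts + del -> forall x y, P x y -> d s x y < 0).
{ intros s hs hlt x y hp. destruct (Rlt_or_le s ts) as [h|h]; [apply below; auto; lra|].
  destruct (Hbd x y hp) as [hx hy].
  replace s with (ts + (s - ts)) by ring.
  apply hd; auto; [rewrite Rabs_pos_eq; lra|lra]. }
destruct (Rlt_or_le t1 (ts + del)) as [h|h]; [apply next; auto|exfalso].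
enough (ts + del / 2 <= ts) by lra.
apply ub. split; [lra|]. intros s x y hs hp. apply next; [lra|lra|exact hp].
Qed.

(** * Functions regular up to the initial time *)

Lemma inI_opp (rho x : R) : inI rho x -> inI rho (- x).
Proof. unfold inI; lra. Qed.

Lemma inI_0 (rho : R) : 0 < rho -> inI rho 0.
Proof. unfold inI; lra. Qed.

Lemma abs_le_inI (rho x y : R) : Rabs x <= y <= rho -> inI rho x /\ inI rho y.
Proof.
intros h. assert (p := Rabs_pos x). assert (q := Rabs_le_between x y). unfold inI.
assert (- y <= x <= y) by (apply q; lra). lra.
Qed.

Definition cont_slab (rho T : R) (v : R -> R -> R) : Prop :=
  forall t x, 0 <= t <= T -> inI rho x -> forall eps, 0 < eps ->
    exists del, 0 < del /\ forall s y, 0 <= s <= T -> inI rho y ->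
      Rabs (s - t) < del -> Rabs (y - x) < del -> Rabs (v s y - v t x) < eps.

(** Only continuity is asked at [t = 0], and no continuity of [vt], [vr], [vrr]: touching occurs at
    a positive time and uses derivatives at the touching points alone. *)
Definition regular (rho T : R) (v vt vr vrr : R -> R -> R) : Prop :=
  cont_slab rho T v /\
  forall t x, 0 < t <= T -> inI rho x ->
    derivable_pt_lim (fun s => v s x) t (vt t x) /\
    derivable_pt_lim (v t) x (vr t x) /\
    derivable_pt_lim (vr t) x (vrr t x).

Lemma regular_shrink (rho T T' : R) (v vt vr vrr : R -> R -> R) :
  T' <= T -> regular rho T v vt vr vrr -> regular rho T' v vt vr vrr.
Proof.
intros h [C D]; split.
- intros t x ht hx eps he. destruct (C t x ltac:(lra) hx eps he) as [del [hd H]].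
  exists del; split; [exact hd|]. intros; apply H; auto; lra.
- intros t x ht hx; apply D; [lra|exact hx].
Qed.

Lemma regular_minus (rho T : R) (v vt vr vrr w wt wr wrr : R -> R -> R) :
  regular rho T v vt vr vrr -> regular rho T w wt wr wrr ->
  regular rho T (fun t x => v t x - w t x) (fun t x => vt t x - wt t x)
    (fun t x => vr t x - wr t x) (fun t x => vrr t x - wrr t x).
Proof.
intros [C D] [C' D']; split.
- intros t x ht hx eps he.
  destruct (C t x ht hx (eps / 2) ltac:(lra)) as [d1 [h1 H1]].
  destruct (C' t x ht hx (eps / 2) ltac:(lra)) as [d2 [h2 H2]].
  exists (Rmin d1 d2); split; [apply Rmin_pos; lra|].
  intros s y hs hy hst hyx.
  assert (a := Rmin_l d1 d2); assert (b := Rmin_r d1 d2).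
  specialize (H1 s y hs hy ltac:(lra) ltac:(lra)).
  specialize (H2 s y hs hy ltac:(lra) ltac:(lra)).
  apply Rabs_def2 in H1; apply Rabs_def2 in H2. apply Rabs_def1; lra.
- intros t x ht hx. destruct (D t x ht hx) as [a [b c]], (D' t x ht hx) as [a' [b' c']].
  repeat split.
  + exact (derivable_pt_lim_minus _ _ _ _ _ a a').
  + exact (derivable_pt_lim_minus _ _ _ _ _ b b').
  + exact (derivable_pt_lim_minus _ _ _ _ _ c c').
Qed.

Definition cont_seg (T : R) (g : R -> R) : Prop :=
  forall t, 0 <= t <= T -> forall eps, 0 < eps -> exists del, 0 < del /\
    forall s, 0 <= s <= T -> Rabs (s - t) < del -> Rabs (g s - g t) < eps.

Lemma derivable_cont_seg (T : R) (g g' : R -> R) :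
  (forall t, 0 <= t <= T -> derivable_pt_lim g t (g' t)) -> cont_seg T g.
Proof.
intros D t ht eps he.
destruct (derivable_pt_lim_continuous _ _ _ (D t ht) eps he) as [del [hd H]].
exists del; split; [exact hd|]. intros s _ hs; exact (H s hs).
Qed.

Lemma continuity_cont_seg (T : R) (g : R -> R) :
  (forall t, 0 <= t <= T -> continuity_pt g t) -> cont_seg T g.
Proof.
intros C t ht eps he. destruct (C t ht eps he) as [d [hd H]]. exists d; split; [exact hd|].
intros s _ hs. destruct (Req_dec t s) as [<-|n].
- rewrite Rminus_diag, Rabs_R0; exact he.
- apply H. split; [split; [exact I|exact n]|exact hs].
Qed.

(** Covers every modification made below: the perturbation in [comparison_strict], the barrier
    [- C * t], the dilation of time in [solution_vt_bound_initial] and the passage to unnormalised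
    time. *)
Lemma regular_reparam (rho T T' : R) (v vt vr vrr : R -> R -> R) (sg sg' g g' : R -> R) :
  regular rho T v vt vr vrr ->
  cont_seg T' sg -> cont_seg T' g ->
  (forall t, 0 <= t <= T' -> 0 <= sg t <= T) ->
  (forall t, 0 < t <= T' -> 0 < sg t) ->
  (forall t, 0 < t <= T' -> derivable_pt_lim sg t (sg' t)) ->
  (forall t, 0 < t <= T' -> derivable_pt_lim g t (g' t)) ->
  regular rho T' (fun t x => v (sg t) x + g t) (fun t x => vt (sg t) x * sg' t + g' t)
    (fun t x => vr (sg t) x) (fun t x => vrr (sg t) x).
Proof.
intros [C D] csg cg rng pos dsg dg; split.
- intros t x ht hx eps he.
  destruct (C (sg t) x (rng t ht) hx (eps / 2) ltac:(lra)) as [d1 [h1 H1]].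
  destruct (csg t ht d1 h1) as [d2 [h2 H2]].
  destruct (cg t ht (eps / 2) ltac:(lra)) as [d3 [h3 H3]].
  exists (Rmin d1 (Rmin d2 d3)); split; [repeat apply Rmin_pos; lra|].
  intros s y hs hy hst hyx.
  assert (a1 := Rmin_l d1 (Rmin d2 d3)). assert (a2 := Rmin_r d1 (Rmin d2 d3)).
  assert (a3 := Rmin_l d2 d3). assert (a4 := Rmin_r d2 d3).
  specialize (H2 s hs ltac:(lra)). specialize (H3 s hs ltac:(lra)).
  specialize (H1 (sg s) y (rng s hs) hy H2 ltac:(lra)).
  apply Rabs_def2 in H1; apply Rabs_def2 in H3. apply Rabs_def1; lra.
- intros t x ht hx. destruct (D (sg t) x) as [a [b c]].
  { split; [apply pos; lra|apply rng; lra]. } { exact hx. }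
  repeat split.
  + apply (derivable_pt_lim_plus (fun s => v (sg s) x) g); [|apply dg; lra].
    exact (derivable_pt_lim_comp sg (fun s => v s x) _ _ _ (dsg t ht) a).
  + replace (vr (sg t) x) with (vr (sg t) x + 0) by ring.
    apply (derivable_pt_lim_plus (v (sg t)) (fun _ => g t));
      [exact b|apply derivable_pt_lim_const].
  + exact c.
Qed.

Lemma regular_zero (rho T : R) :
  regular rho T (fun _ _ => 0) (fun _ _ => 0) (fun _ _ => 0) (fun _ _ => 0).
Proof.
split.
- intros t x _ _ eps he. exists 1; split; [lra|]. intros.
  rewrite Rminus_diag, Rabs_R0; exact he.
- intros; repeat split; apply derivable_pt_lim_const.
Qed.

(** * One-point and two-point maximum principles *)

Lemma max_principle (rho T : R) (d dt dr drr : R -> R -> R) :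
  0 < rho -> regular rho T d dt dr drr ->
  (forall x, inI rho x -> d 0 x < 0) ->
  (forall t x, 0 < t <= T -> - rho < x < rho -> d t x = 0 ->
     0 <= dt t x -> dr t x = 0 -> drr t x <= 0 -> False) ->
  (forall t, 0 < t <= T -> d t rho = 0 -> 0 <= dr t rho -> False) ->
  (forall t, 0 < t <= T -> d t (- rho) = 0 -> dr t (- rho) <= 0 -> False) ->
  forall t x, 0 <= t <= T -> inI rho x -> d t x < 0.
Proof.
intros hrho [C D] H0 Hin Hr Hl t x ht hx.
(* The second variable is a dummy, so that the two-point lemma also serves functions of one
   point. *)
apply (first_touching T rho (fun x y => inI rho x /\ inI rho y) (fun t x _ => d t x))
  with (y := x); [| | | | |exact ht|split; exact hx].
- intros p q [hp hq]; split; assumption.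
- intros p q n.
  assert (far : forall z, ~ inI rho z ->
            exists del, 0 < del /\ forall z', Rabs (z' - z) < del -> ~ inI rho z').
  { unfold inI. intros z nz. destruct (Rlt_or_le rho z) as [h|h].
    - exists (z - rho); split; [lra|]. intros z' hz. apply Rabs_def2 in hz. lra.
    - exists (- rho - z); split; [lra|]. intros z' hz. apply Rabs_def2 in hz. lra. }
  destruct (classic (inI rho p)) as [hp|np].
  + destruct (far q) as [del [hd H]]; [tauto|]. exists del; split; [exact hd|].
    intros x' y' _ hy [_ k]; exact (H y' hy k).
  + destruct (far p np) as [del [hd H]]. exists del; split; [exact hd|].
    intros x' y' hy _ [k _]; exact (H x' hy k).
- intros s p q hs [hp _] eps he. destruct (C s p hs hp eps he) as [del [hd H]].
  exists del; split; [exact hd|]. intros s' p' q' hs' [hp' _] k1 k2 _. auto.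
- intros p q [hp _]; auto.
- intros s p q hs [hp _] e M.
  destruct (D s p hs hp) as [a [b c]].
  assert (t0 : 0 <= dt s p).
  { apply (derive_at_left_max (fun s => d s p) 0 s); [exact a|lra|].
    intros y hy; simpl. rewrite e. apply (M y p p); [lra|split; assumption]. }
  assert (M' : forall y, - rho <= y <= rho -> d s y <= d s p).
  { intros y hy; rewrite e; apply (M s y y); [lra|split; exact hy]. }
  destruct (Req_dec p rho) as [->|n1].
  { apply (Hr s hs e).
    apply (derive_at_left_max (d s) (- rho) rho); [exact b|lra|]. intros; apply M'; lra. }
  destruct (Req_dec p (- rho)) as [->|n2].
  { apply (Hl s hs e).
    apply (derive_at_right_max (d s) rho (- rho)); [exact b|lra|]. intros; apply M'; lra. }
  unfold inI in hp.
  destruct (derive_at_inner_max (d s) (dr s) (- rho) rho p (drr s p)) as [z1 z2];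
    [intros y hy; apply (D s y hs hy)|exact c|lra|exact M'|].
  apply (Hin s p hs); auto; lra.
Qed.

(** With [Rabs x <= y] instead of [0 <= x <= y] the middle needs no boundary condition: at a
    touching pair [x] maximises [D t] over [[-y, y]], an interior maximum even for [x = 0], and [y]
    minimises it over [[Rabs x, rho]]. Evenness and [Y > 0] exclude [Rabs x = y]; the condition on
    [Dr t rho] excludes [y = rho]. *)
Lemma two_point_max_principle (rho T : R) (D Dt Dr Drr : R -> R -> R) (Y Y' : R -> R) :
  0 < rho -> regular rho T D Dt Dr Drr ->
  (forall t x, 0 <= t <= T -> inI rho x -> D t (- x) = D t x) ->
  (forall t, 0 <= t <= T -> 0 < Y t) ->
  (forall t, 0 <= t <= T -> derivable_pt_lim Y t (Y' t)) ->
  (forall x y, Rabs x <= y <= rho -> D 0 x - D 0 y < Y 0) ->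
  (forall t x, 0 < t <= T -> inI rho x -> D t x - D t rho = Y t -> 0 < Dr t rho) ->
  (forall t x y, 0 < t <= T -> Rabs x < y < rho -> D t x - D t y = Y t ->
     Dr t x = 0 -> Dr t y = 0 -> Drr t x <= 0 -> 0 <= Drr t y -> Dt t x - Dt t y < Y' t) ->
  forall t x y, 0 <= t <= T -> Rabs x <= y <= rho -> D t x - D t y < Y t.
Proof.
intros hrho [C Der] even Ypos DY H0 Hbd Hin t x y ht hxy.
assert (box := abs_le_inI rho).
enough (D t x - D t y - Y t < 0) by lra.
apply (first_touching T rho (fun x y => Rabs x <= y <= rho)
         (fun t x y => D t x - D t y - Y t)); [exact box| | | | |exact ht|exact hxy];
  clear t x y ht hxy.
- intros x y n.
  destruct (Rle_or_lt y rho) as [h|h].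
  + assert (h' : y < Rabs x) by (apply Rnot_le_lt; tauto).
    exists ((Rabs x - y) / 2); split; [lra|]. intros x' y' hx hy k.
    assert (a := Rabs_triang_inv x x'). rewrite (Rabs_minus_sym x x') in a.
    apply Rabs_def2 in hy. lra.
  + exists (y - rho); split; [lra|]. intros x' y' hx hy k. apply Rabs_def2 in hy. lra.
- intros t x y ht hxy eps he. destruct (box x y hxy) as [hx hy].
  destruct (C t x ht hx (eps / 3) ltac:(lra)) as [d1 [p1 H1]].
  destruct (C t y ht hy (eps / 3) ltac:(lra)) as [d2 [p2 H2]].
  destruct (derivable_pt_lim_continuous _ _ _ (DY t ht) (eps / 3) ltac:(lra)) as [d3 [p3 H3]].
  exists (Rmin d1 (Rmin d2 d3)); split; [repeat apply Rmin_pos; lra|].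
  intros s x' y' hs hxy' k1 k2 k3. destruct (box x' y' hxy') as [hx' hy'].
  assert (a1 := Rmin_l d1 (Rmin d2 d3)). assert (a2 := Rmin_r d1 (Rmin d2 d3)).
  assert (a3 := Rmin_l d2 d3). assert (a4 := Rmin_r d2 d3).
  specialize (H1 s x' hs hx' ltac:(lra) ltac:(lra)).
  specialize (H2 s y' hs hy' ltac:(lra) ltac:(lra)).
  specialize (H3 s ltac:(lra)).
  apply Rabs_def2 in H1; apply Rabs_def2 in H2; apply Rabs_def2 in H3. apply Rabs_def1; lra.
- intros x y hxy; specialize (H0 x y hxy); lra.
- intros t x y ht hxy e M. destruct (box x y hxy) as [hx hy].
  assert (Y0 := Ypos t ltac:(lra)).
  assert (Mt : forall x' y', Rabs x' <= y' <= rho -> D t x' - D t y' <= D t x - D t y).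
  { intros x' y' h. specialize (M t x' y' ltac:(lra) h). lra. }
  assert (lt_xy : Rabs x < y).
  { destruct (proj1 hxy) as [h|h]; [exact h|exfalso]. unfold Rabs in h.
    destruct (Rcase_abs x); subst y; [rewrite even in e by (auto; lra)|]; lra. }
  apply Rabs_def2 in lt_xy as xy.
  destruct (Der t x ht hx) as [ax [bx cx]], (Der t y ht hy) as [ay [by' cy]].
  assert (byn := derivable_pt_lim_opp _ _ _ by').
  assert (cyn := derivable_pt_lim_opp _ _ _ cy).
  assert (My : forall y', Rabs x <= y' <= rho -> - D t y' <= - D t y).
  { intros y' h. specialize (Mt x y' h). lra. }
  destruct (Req_dec y rho) as [->|ne].
  { assert (q := derive_at_left_max _ (Rabs x) rho _ byn lt_xy).
    unfold opp_fct in q. specialize (q My).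
    specialize (Hbd t x ht hx ltac:(lra)). lra. }
  assert (hyr : y < rho) by lra.
  destruct (derive_at_inner_max (D t) (Dr t) (- y) y x (Drr t x)) as [z1 z2];
    [|exact cx|lra| |].
  { intros z hz. apply (Der t z ht). unfold inI; lra. }
  { intros z hz. specialize (Mt z y). enough (D t z - D t y <= D t x - D t y) by lra.
    apply Mt. split; [apply Rabs_le; lra|lra]. }
  assert (ha := Rabs_pos x).
  destruct (derive_at_inner_max (fun z => - D t z) (fun z => - Dr t z) (Rabs x) rho y (- Drr t y))
    as [z3 z4]; [|exact cyn|lra|exact My|].
  { intros z hz. apply derivable_pt_lim_opp, (Der t z ht). unfold inI; lra. }
  specialize (Hin t x y ht (conj lt_xy hyr) ltac:(lra) z1 ltac:(lra) z2 ltac:(lra)).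
  assert (Q := derivable_pt_lim_minus _ _ _ _ _ (derivable_pt_lim_minus _ _ _ _ _ ax ay)
                 (DY t ltac:(lra))).
  assert (q := derive_at_left_max _ 0 t _ Q ltac:(lra)).
  unfold minus_fct in q.
  enough (0 <= Dt t x - Dt t y - Y' t) by lra.
  apply q. intros s hs. rewrite e. apply M; [lra|exact hxy].
Qed.

Lemma exp_le_1_plus_triple (x : R) : 0 <= x <= 1 -> exp x <= 1 + 3 * x.
Proof.
intros hx. destruct (Req_dec x 0) as [->|n]; [rewrite exp_0; lra|].
destruct (MVT_cor2 exp exp 0 x) as [y [e hy]]; [lra|intros; apply derivable_pt_lim_exp|].
rewrite exp_0 in e.
assert (exp y < exp 1) by (apply exp_increasing; lra).
assert (h := exp_le_3). nra.
Qed.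

(** * The unnormalised flow *)

Section UnnormalisedFlow.

Variables (rho k0 : R) (c K : R -> R).
Hypothesis rho_pos : 0 < rho.
Hypothesis k0_neg : k0 < 0.

(** Minus the Gauss curvature of e^{2v} g0; later [c] is f'/f and [K] is -f''/f, the Gauss curvature
    of g0. *)
Definition speed (v vr vrr : R -> R -> R) (t x : R) : R :=
  exp (-2 * v t x) * (vrr t x + c x * vr t x - K x).

(** The boundary inequalities come from solving e^{-v} (k0 + outward derivative of v) = k0 for the
    outward derivative. *)
Definition subsol (T : R) (v vt vr vrr : R -> R -> R) : Prop :=
  regular rho T v vt vr vrr /\
  (forall t x, 0 < t <= T -> inI rho x -> vt t x <= speed v vr vrr t x) /\
  (forall t, 0 < t <= T -> vr t rho <= k0 * (exp (v t rho) - 1)) /\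
  (forall t, 0 < t <= T -> - vr t (- rho) <= k0 * (exp (v t (- rho)) - 1)).

Definition supersol (T : R) (v vt vr vrr : R -> R -> R) : Prop :=
  regular rho T v vt vr vrr /\
  (forall t x, 0 < t <= T -> inI rho x -> speed v vr vrr t x <= vt t x) /\
  (forall t, 0 < t <= T -> k0 * (exp (v t rho) - 1) <= vr t rho) /\
  (forall t, 0 < t <= T -> k0 * (exp (v t (- rho)) - 1) <= - vr t (- rho)).

(* [lambda h(sg(t))] with [sg' = 1/lambda] and [lambda > 1] increasing turns a
   supersolution [h = e^{2w}] into a strict one, also at the boundary; at a
   touching point no bound on second derivatives is needed. *)
Lemma comparison_strict (T e : R) (v vt vr vrr w wt wr wrr : R -> R -> R) :
  0 < e -> e * (1 + 2 * T) < 1 ->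
  subsol T v vt vr vrr -> supersol T w wt wr wrr ->
  (forall x, inI rho x -> v 0 x <= w 0 x) ->
  forall t x, 0 <= t <= T -> inI rho x ->
    v t x < w ((1 - e) * t - e * t ^ 2) x - / 2 * ln (1 - e - 2 * e * t).
Proof.
intros he heT [Rv [Sv [Bv1 Bv2]]] [Rw [Sw [Bw1 Bw2]]] H0 t x ht hx.
assert (T0 : 0 <= T) by lra.
(* Here [sg'] is [1/lambda] and [g] is half the logarithm of [lambda]. Since [sg'] is below 1,
   [g > 0], which gives strictness at the boundary; since [sg'] decreases, [g' > 0], which gives
   strictness inside. *)
set (sg := fun t => (1 - e) * t - e * t ^ 2).
set (sg' := fun t => 1 - e - 2 * e * t).
set (g := fun t => - / 2 * ln (sg' t)).
set (g' := fun t => e / sg' t).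
assert (q : forall t, 0 <= t <= T -> 0 < sg' t < 1) by (intros s hs; unfold sg'; split; nra).
assert (sgpos : forall t, 0 < t <= T -> 0 < sg t <= T) by (intros s hs; unfold sg; split; nra).
assert (sg0 : sg 0 = 0) by (unfold sg; ring).
assert (Rw' : regular rho T (fun t x => w (sg t) x + g t)
          (fun t x => wt (sg t) x * sg' t + g' t)
          (fun t x => wr (sg t) x) (fun t x => wrr (sg t) x)).
{ assert (dsg : forall t, derivable_pt_lim sg t (sg' t)).
  { intros s. apply is_derive_Reals. unfold sg, sg'. auto_derive; [exact I|ring]. }
  assert (dg : forall t, 0 <= t <= T -> derivable_pt_lim g t (g' t)).
  { intros s hs. specialize (q s hs). apply is_derive_Reals. unfold g, g', sg' in *.
    auto_derive; [lra|field; lra]. }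
  apply (regular_reparam rho T T) with (1 := Rw).
  - apply derivable_cont_seg with sg'. intros; apply dsg.
  - apply derivable_cont_seg with g'. exact dg.
  - intros s hs. destruct (Req_dec s 0) as [->|n]; [rewrite sg0; lra|].
    assert (z := sgpos s ltac:(lra)); lra.
  - intros s hs; apply sgpos; exact hs.
  - intros s _; apply dsg.
  - intros s hs; apply dg; lra. }
assert (lam : forall t, 0 <= t <= T -> 0 < g t).
{ intros s hs. specialize (q s hs). unfold g.
  assert (ln (sg' s) < 0) by (rewrite <- ln_1; apply ln_increasing; lra). lra. }
assert (el : forall t, 0 <= t <= T -> exp (-2 * g t) = sg' t).
{ intros s hs. unfold g. replace (-2 * (- / 2 * ln (sg' s))) with (ln (sg' s)) by field.
  apply exp_ln, q, hs. }
assert (R := regular_minus _ _ _ _ _ _ _ _ _ _ Rv Rw').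
enough (G : v t x - (w (sg t) x + g t) < 0) by (unfold g, sg, sg' in G; lra).
refine (max_principle rho T _ _ _ _ rho_pos R _ _ _ _ t x ht hx); clear t x ht hx.
- intros x hx. rewrite sg0. specialize (H0 x hx). specialize (lam 0 ltac:(lra)). lra.
- intros t x ht hx e0 h1 h2 h3.
  assert (hx' : inI rho x) by (unfold inI; lra).
  specialize (Sv t x ht hx'). specialize (Sw (sg t) x (sgpos t ht) hx').
  specialize (q t ltac:(lra)). specialize (el t ltac:(lra)).
  unfold speed in *.
  (* At the touching point [exp (-2 * v)] is [E * sg'], and the time change multiplies [wt] by the
     same factor [sg']. Only the sign of [vrr - wrr] is then needed. *)
  replace (-2 * v t x) with (-2 * w (sg t) x + -2 * g t) in Sv by lra.
  rewrite exp_plus, el in Sv.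
  assert (p := exp_pos (-2 * w (sg t) x)).
  set (E := exp (-2 * w (sg t) x)) in *.
  replace (vr t x) with (wr (sg t) x) in Sv by lra.
  assert (0 < g' t) by (unfold g'; apply Rdiv_lt_0_compat; lra).
  set (S := wrr (sg t) x + c x * wr (sg t) x - K x) in *.
  assert (E * sg' t * (vrr t x + c x * wr (sg t) x - K x) <= E * sg' t * S).
  { apply Rmult_le_compat_l; [apply Rmult_le_pos; lra|unfold S; lra]. }
  assert (E * S * sg' t <= wt (sg t) x * sg' t) by (apply Rmult_le_compat_r; lra).
  nra.
- intros t ht e0 h1.
  specialize (Bv1 t ht). specialize (Bw1 (sg t) (sgpos t ht)). specialize (lam t ltac:(lra)).
  assert (exp (w (sg t) rho) < exp (v t rho)) by (apply exp_increasing; lra).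
  nra.
- intros t ht e0 h1.
  specialize (Bv2 t ht). specialize (Bw2 (sg t) (sgpos t ht)). specialize (lam t ltac:(lra)).
  assert (exp (w (sg t) (- rho)) < exp (v t (- rho))) by (apply exp_increasing; lra).
  nra.
Qed.

Lemma comparison (T : R) (v vt vr vrr w wt wr wrr : R -> R -> R) :
  subsol T v vt vr vrr -> supersol T w wt wr wrr ->
  (forall x, inI rho x -> v 0 x <= w 0 x) ->
  forall t x, 0 <= t <= T -> inI rho x -> v t x <= w t x.
Proof.
intros Sv Sw H0 t x ht hx.
destruct (Rle_or_lt (v t x) (w t x)) as [h|h]; [exact h|exfalso].
set (eta := (v t x - w t x) / 2). assert (heta : 0 < eta) by (unfold eta; lra).
destruct (proj1 (proj1 Sw) t x ht hx eta heta) as [d1 [h1 H1]].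
assert (De : derivable_pt_lim (fun e => - / 2 * ln (1 - e - 2 * e * t)) 0 (/ 2 + t)).
{ apply is_derive_Reals. auto_derive; [lra|field]. }
destruct (derivable_pt_lim_continuous _ _ _ De eta heta) as [d2 [h2 H2]].
(* The first bound gives [e * (1 + 2 * T) < 1], the second keeps the perturbed time within [d1] of
   [t], and the third keeps the logarithmic term below [eta]. *)
set (e := Rmin (/ (2 + 2 * T)) (Rmin (d1 / (2 * (1 + t + t ^ 2))) (d2 / 2))).
assert (p0 : 0 < / (2 + 2 * T)) by (apply Rinv_0_lt_compat; lra).
assert (p1 : 0 < d1 / (2 * (1 + t + t ^ 2))) by (apply Rdiv_lt_0_compat; nra).
assert (he : 0 < e) by (unfold e; repeat apply Rmin_pos; lra).
assert (e1 : e <= / (2 + 2 * T)) by apply Rmin_l.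
assert (e2 : e <= d1 / (2 * (1 + t + t ^ 2)))
  by (unfold e; eapply Rle_trans; [apply Rmin_r|apply Rmin_l]).
assert (e3 : e <= d2 / 2) by (unfold e; eapply Rle_trans; [apply Rmin_r|apply Rmin_r]).
assert (i : (2 + 2 * T) * / (2 + 2 * T) = 1) by (field; lra).
assert (heT : e * (1 + 2 * T) < 1) by nra.
assert (q := comparison_strict T e v vt vr vrr w wt wr wrr he heT Sv Sw H0 t x ht hx).
assert (e2' : e * (2 * (1 + t + t ^ 2)) <= d1).
{ replace d1 with (d1 / (2 * (1 + t + t ^ 2)) * (2 * (1 + t + t ^ 2))) by (field; nra).
  apply Rmult_le_compat_r; nra. }
specialize (H1 ((1 - e) * t - e * t ^ 2) x).
specialize (H2 e).
rewrite Rminus_0_r in H2. rewrite Rabs_pos_eq in H2 by lra.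
specialize (H2 ltac:(lra)).
replace (1 - 0 - 2 * 0 * t) with 1 in H2 by ring. rewrite ln_1 in H2.
assert (r1 : 0 <= (1 - e) * t - e * t ^ 2 <= T) by nra.
assert (r2 : Rabs ((1 - e) * t - e * t ^ 2 - t) < d1).
{ apply Rabs_def1; nra. }
specialize (H1 r1 hx r2). rewrite Rminus_diag, Rabs_R0 in H1. specialize (H1 h1).
apply Rabs_def2 in H1. apply Rabs_def2 in H2. unfold eta in *. lra.
Qed.

Definition solution (T : R) (v vt vr vrr : R -> R -> R) : Prop :=
  regular rho T v vt vr vrr /\
  (forall t x, 0 < t <= T -> inI rho x -> vt t x = speed v vr vrr t x) /\
  (forall t, 0 < t <= T -> vr t rho = k0 * (exp (v t rho) - 1)) /\
  (forall t, 0 < t <= T -> - vr t (- rho) = k0 * (exp (v t (- rho)) - 1)).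

Lemma solution_subsol (T : R) (v vt vr vrr : R -> R -> R) :
  solution T v vt vr vrr -> subsol T v vt vr vrr.
Proof.
intros [h1 [h2 [h3 h4]]]. split; [exact h1|]. repeat split; intros; right; auto.
Qed.

Lemma solution_supersol (T : R) (v vt vr vrr : R -> R -> R) :
  solution T v vt vr vrr -> supersol T v vt vr vrr.
Proof.
intros [h1 [h2 [h3 h4]]]. split; [exact h1|].
repeat split; intros; right; symmetry; auto.
Qed.

Lemma solution_shrink (T T' : R) (v vt vr vrr : R -> R -> R) :
  T' <= T -> solution T v vt vr vrr -> solution T' v vt vr vrr.
Proof.
intros h [h1 [h2 [h3 h4]]]. split; [exact (regular_shrink _ _ _ _ _ _ _ h h1)|].
repeat split; intros.
- apply h2; auto; lra.
- apply h3; lra.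
- apply h4; lra.
Qed.

Lemma solution_shift (T tau : R) (v vt vr vrr : R -> R -> R) :
  0 <= tau -> solution T v vt vr vrr ->
  solution (T - tau) (fun t => v (t + tau)) (fun t => vt (t + tau))
    (fun t => vr (t + tau)) (fun t => vrr (t + tau)).
Proof.
intros ht [[C D] [h2 [h3 h4]]]. repeat split.
- intros t x hs hx eps he. destruct (C (t + tau) x ltac:(lra) hx eps he) as [del [hd H]].
  exists del; split; [exact hd|]. intros s y hs' hy k1 k2. apply H; auto; [lra|].
  replace (s + tau - (t + tau)) with (s - t) by ring. exact k1.
- destruct (D (t + tau) x ltac:(lra) ltac:(auto)) as [a _].
  replace (vt (t + tau) x) with (vt (t + tau) x * 1) by ring.
  apply (derivable_pt_lim_comp (fun s => s + tau) (fun s => v s x)); [|exact a].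
  apply is_derive_Reals. auto_derive; [exact I|ring].
- apply (D (t + tau) x ltac:(lra) ltac:(auto)).
- apply (D (t + tau) x ltac:(lra) ltac:(auto)).
- intros. apply h2; auto; lra.
- intros. apply h3; lra.
- intros. apply h4; lra.
Qed.

Hypothesis c_odd : forall x, inI rho x -> c (- x) = - c x.
Hypothesis K_nonneg : forall x, inI rho x -> 0 <= K x.
Hypothesis K_decr : forall r s, inI rho r -> inI rho s -> Rabs r <= Rabs s -> K s <= K r.

Lemma K_even (x : R) : inI rho x -> K (- x) = K x.
Proof.
intros hx; assert (hx' := inI_opp rho x hx).
apply Rle_antisym; apply K_decr; auto; rewrite Rabs_Ropp; lra.
Qed.

Lemma K_le_K0 (x : R) : inI rho x -> K x <= K 0.
Proof. intros hx; apply K_decr; auto using inI_0. rewrite Rabs_R0; apply Rabs_pos. Qed.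

Lemma solution_reflect (T : R) (v vt vr vrr : R -> R -> R) :
  solution T v vt vr vrr ->
  solution T (fun t x => v t (- x)) (fun t x => vt t (- x))
    (fun t x => - vr t (- x)) (fun t x => vrr t (- x)).
Proof.
intros [[C D] [h2 [h3 h4]]]. repeat split.
- intros t x hs hx eps he.
  destruct (C t (- x) hs (inI_opp _ _ hx) eps he) as [del [hd H]].
  exists del; split; [exact hd|]. intros s y hs' hy k1 k2. apply H; auto using inI_opp.
  replace (- y - - x) with (- (y - x)) by ring. rewrite Rabs_Ropp; exact k2.
- apply (D t (- x)); auto using inI_opp.
- apply derivable_pt_lim_comp_opp. apply (D t (- x)); auto using inI_opp.
- replace (vrr t (- x)) with (- - vrr t (- x)) by ring.
  apply derivable_pt_lim_opp, derivable_pt_lim_comp_opp.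
  apply (D t (- x)); auto using inI_opp.
- intros t x ht hx. rewrite h2; auto using inI_opp. unfold speed.
  rewrite c_odd, K_even by assumption. ring.
- intros t ht. apply h4, ht.
- intros t ht. rewrite Ropp_involutive, Ropp_involutive. apply h3, ht.
Qed.

(** * Solutions starting at v = 0: symmetry, sign and a bound of the time derivative *)

Section InitialValueZero.

Variables (T : R) (v vt vr vrr : R -> R -> R).
Hypothesis sol : solution T v vt vr vrr.
Hypothesis v_init : forall x, inI rho x -> v 0 x = 0.

(** Uniqueness: [v] and its reflection are solutions with the same initial value, so they are
    compared in both directions. *)
Lemma solution_even (t x : R) : 0 <= t <= T -> inI rho x -> v t (- x) = v t x.
Proof.
intros ht hx. assert (sol' := solution_reflect _ _ _ _ _ sol).
apply Rle_antisym.
- apply (comparison T (fun t x => v t (- x)) _ _ _ v _ _ _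
           (solution_subsol _ _ _ _ _ sol') (solution_supersol _ _ _ _ _ sol)); auto.
  intros y hy; rewrite !v_init; auto using inI_opp; lra.
- apply (comparison T v _ _ _ (fun t x => v t (- x)) _ _ _
           (solution_subsol _ _ _ _ _ sol) (solution_supersol _ _ _ _ _ sol')); auto.
  intros y hy; rewrite !v_init; auto using inI_opp; lra.
Qed.

Lemma solution_nonpos (t x : R) : 0 <= t <= T -> inI rho x -> v t x <= 0.
Proof.
intros ht hx.
apply (comparison T v _ _ _ (fun _ _ => 0) (fun _ _ => 0) (fun _ _ => 0) (fun _ _ => 0)
  (solution_subsol _ _ _ _ _ sol)); auto.
- split; [apply regular_zero|]. repeat split.
  + intros s y _ hy. unfold speed. rewrite Rmult_0_r, exp_0.
    assert (k := K_nonneg y hy). lra.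
  + intros; rewrite exp_0; lra.
  + intros; rewrite exp_0; lra.
- intros y hy; rewrite v_init; auto; lra.
Qed.

Lemma solution_decr_time (t tau x : R) :
  0 <= t -> 0 <= tau -> t + tau <= T -> inI rho x -> v (t + tau) x <= v t x.
Proof.
intros ht hta hT hx.
apply (comparison (T - tau) (fun t => v (t + tau)) _ _ _ v vt vr vrr
  (solution_subsol _ _ _ _ _ (solution_shift T tau v vt vr vrr hta sol))); auto.
- apply solution_supersol, solution_shrink with (2 := sol); lra.
- intros y hy. rewrite Rplus_0_l, v_init by auto. apply solution_nonpos; auto; lra.
- lra.
Qed.

(** This is the preservation of nonnegative curvature. *)
Lemma solution_vt_nonpos (t x : R) : 0 < t <= T -> inI rho x -> vt t x <= 0.
Proof.
intros ht hx. destruct (proj2 (proj1 sol) t x ht hx) as [D _].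
apply derivable_pt_lim_opp in D.
enough (0 <= - vt t x) by lra.
apply (derive_at_left_max _ 0 t _ D); [lra|]. intros y hy. unfold opp_fct.
assert (h := solution_decr_time y (t - y) x ltac:(lra) ltac:(lra) ltac:(lra) hx).
replace (y + (t - y)) with t in h by ring. lra.
Qed.

(** While [2 * C * t <= 1], the factor [exp (2 * C * t)] is at most [exp 1 <= 3]. Since
    [3 * K 0 <= C] and [K] is largest in the middle, [- C * t] is a subsolution; its boundary
    inequality holds because [k0 < 0] and the barrier is negative. *)
Lemma solution_lower_barrier (C t x : R) :
  3 * K 0 <= C -> 0 < C -> 2 * C * t <= 1 -> 0 <= t <= T -> inI rho x -> - C * t <= v t x.
Proof.
intros hK hC hCt ht hx.
assert (Rz := regular_reparam rho T t _ _ _ _ (fun s => s) (fun _ => 1)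
  (fun s => - C * s) (fun _ => - C) (regular_zero rho T)).
enough (0 + - C * t <= v t x) by lra.
apply (comparison t (fun s _ => 0 + - C * s) (fun _ _ => 0 * 1 + - C)
  (fun _ _ => 0) (fun _ _ => 0) v vt vr vrr); [|apply solution_supersol; apply solution_shrink with T; [lra|exact sol]| |lra|exact hx].
- assert (dg : forall s, derivable_pt_lim (fun s => - C * s) s (- C)).
  { intros s. apply is_derive_Reals. auto_derive; [exact I|ring]. }
  split; [apply Rz|].
  + apply derivable_cont_seg with (fun _ => 1). intros; apply derivable_pt_lim_id.
  + apply derivable_cont_seg with (fun _ => - C). intros; apply dg.
  + intros; lra.
  + intros; lra.
  + intros; apply derivable_pt_lim_id.
  + intros; apply dg.
  + repeat split.
    * intros s y hs hy. unfold speed.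
      assert (p := exp_pos (-2 * (0 + - C * s))).
      assert (exp (-2 * (0 + - C * s)) <= 3).
      { apply Rle_trans with (exp 1); [|apply exp_le_3].
        destruct (Req_dec (-2 * (0 + - C * s)) 1) as [->|n]; [lra|].
        left; apply exp_increasing; nra. }
      assert (k1 := K_nonneg y hy). assert (k2 := K_le_K0 y hy). nra.
    * intros s hs. assert (exp (0 + - C * s) < 1) by (rewrite <- exp_0; apply exp_increasing; nra).
      nra.
    * intros s hs. assert (exp (0 + - C * s) < 1) by (rewrite <- exp_0; apply exp_increasing; nra).
      nra.
- intros y hy. rewrite v_init by auto. lra.
Qed.

(* Compare [v(t + tau)] with the subsolution [v(e^{2 C tau} t) - C tau], and
   differentiate at [tau = 0]. *)
Lemma solution_vt_bound_initial (C t x : R) :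
  3 * K 0 <= C -> 0 < C -> 4 * C * t <= 1 -> 0 < t < T -> inI rho x -> - (2 * C) <= vt t x.
Proof.
intros hK hC hCt ht hx.
assert (Dexp : derivable_pt_lim (fun tau => exp (2 * C * tau) * t) 0 (2 * C * t)).
{ apply is_derive_Reals. auto_derive; [exact I|rewrite Rmult_0_r, exp_0; ring]. }
destruct (derivable_pt_lim_continuous _ _ _ Dexp (T - t) ltac:(lra)) as [d [hd Hd]].
rewrite Rmult_0_r, exp_0 in Hd.
assert (pC : 0 < / (2 * C)) by (apply Rinv_0_lt_compat; lra).
assert (qC : 2 * C * / (2 * C) = 1) by (field; lra).
(* The three bounds keep the dilated time below [T], keep [t + tau] within [T], and allow the lower
   barrier to be used at time [tau], where it gives the initial inequality. *)
set (b := Rmin (d / 2) (Rmin (T - t) (/ (2 * C)))).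
assert (hb : 0 < b) by (unfold b; repeat apply Rmin_pos; lra).
assert (b1 : b <= d / 2) by apply Rmin_l.
assert (b2 : b <= T - t) by (unfold b; eapply Rle_trans; [apply Rmin_r|apply Rmin_l]).
assert (b3 : b <= / (2 * C)) by (unfold b; eapply Rle_trans; [apply Rmin_r|apply Rmin_r]).
assert (key : forall tau, 0 <= tau <= b ->
          v (exp (2 * C * tau) * t) x + - C * tau <= v (t + tau) x).
{ intros tau hta. set (E := exp (2 * C * tau)).
  assert (E1 : 1 <= E).
  { unfold E. assert (h := exp_ineq1_le (2 * C * tau)). nra. }
  assert (Et : E * t < T).
  { specialize (Hd tau). rewrite Rminus_0_r, Rabs_pos_eq in Hd by lra.
    specialize (Hd ltac:(lra)). apply Rabs_def2 in Hd. fold E in Hd. lra. }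
  assert (Rz := regular_reparam rho T t v vt vr vrr (fun s => E * s) (fun _ => E)
    (fun s => - C * tau) (fun _ => 0) (proj1 sol)).
  destruct sol as [_ [h2 [h3 h4]]].
  assert (rng : forall s, 0 < s <= t -> 0 < E * s <= T) by (intros; nra).
  assert (lowexp : forall s y, exp (v (E * s) y + - C * tau) <= exp (v (E * s) y)).
  { intros s y. destruct (Req_dec tau 0) as [->|n].
    - right; f_equal; ring.
    - left; apply exp_increasing; nra. }
  apply (comparison t (fun s y => v (E * s) y + - C * tau) (fun s y => vt (E * s) y * E + 0)
    (fun s => vr (E * s)) (fun s => vrr (E * s))
    (fun s => v (s + tau)) (fun s => vt (s + tau)) (fun s => vr (s + tau))
    (fun s => vrr (s + tau))).
  - assert (dE : forall s, derivable_pt_lim (fun s => E * s) s E).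
    { intros s. apply is_derive_Reals. auto_derive; [exact I|ring]. }
    split; [apply Rz|].
    + apply derivable_cont_seg with (fun _ => E). intros; apply dE.
    + apply derivable_cont_seg with (fun _ => 0). intros; apply derivable_pt_lim_const.
    + intros s hs; nra.
    + intros s hs; nra.
    + intros s hs. apply dE.
    + intros s hs. apply derivable_pt_lim_const.
    + repeat split.
      (* Scaling: the factor [E] of the time dilation equals [exp (-2 * (- C * tau))], so the
         interior equation holds exactly; only the boundary condition becomes an inequality. *)
      * intros s y hs hy. rewrite h2 by auto. unfold speed.
        replace (-2 * (v (E * s) y + - C * tau)) with (-2 * v (E * s) y + 2 * C * tau) by ring.
        rewrite exp_plus. fold E. right; ring.
      * intros s hs. rewrite h3 by auto. specialize (lowexp s rho). nra.
      * intros s hs. rewrite h4 by auto. specialize (lowexp s (- rho)). nra.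
  - apply solution_supersol. apply solution_shrink with (T - tau); [lra|].
    apply solution_shift; [lra|exact sol].
  - intros y hy. rewrite Rmult_0_r, Rplus_0_l, v_init by auto. rewrite Rplus_0_l.
    apply solution_lower_barrier; auto; nra.
  - lra.
  - exact hx. }
destruct (proj2 (proj1 sol) t x ltac:(lra) hx) as [D _].
assert (D1 : derivable_pt_lim (fun tau => v (exp (2 * C * tau) * t) x) 0 (vt t x * (2 * C * t))).
{ apply (derivable_pt_lim_comp (fun tau => exp (2 * C * tau) * t) (fun s => v s x)).
  - exact Dexp.
  - rewrite Rmult_0_r, exp_0, Rmult_1_l. exact D. }
assert (D2 : derivable_pt_lim (fun tau => v (t + tau) x) 0 (vt t x * 1)).
{ apply (derivable_pt_lim_comp (fun tau => t + tau) (fun s => v s x)).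
  - apply is_derive_Reals. auto_derive; [exact I|ring].
  - rewrite Rplus_0_r. exact D. }
assert (D3 : derivable_pt_lim (fun tau => - C * tau) 0 (- C)).
{ apply is_derive_Reals. auto_derive; [exact I|ring]. }
assert (D4 := derivable_pt_lim_minus _ _ _ _ _ (derivable_pt_lim_plus _ _ _ _ _ D1 D3) D2).
assert (q := derive_at_right_max _ b 0 _ D4 hb).
unfold minus_fct, plus_fct in q.
rewrite !Rmult_0_r, exp_0, Rmult_1_l, Rplus_0_r in q.
assert (q' : vt t x * (2 * C * t) + - C - vt t x * 1 <= 0).
{ apply q. intros y hy. specialize (key y hy). rewrite (Rplus_0_r t). lra. }
(* Because [4 * C * t <= 1], the coefficient [1 - 2 * C * t] of [- vt] is at least 1/2; this is
   where the factor 2 in the bound arises. *)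
assert (n := solution_vt_nonpos t x ltac:(lra) hx).
nra.
Qed.

(** * Monotonicity in space, given a lower bound of the time derivative *)

Variable B : R.
Hypothesis B_pos : 0 < B.
Hypothesis vt_bound : forall t x, 0 < t < T -> inI rho x -> - B <= vt t x.

(** For [t = 0] there is no derivative to integrate, so the mean value theorem starts at [t + s],
    and continuity makes the loss smaller than the assumed violation [eta]. *)
Lemma solution_increment_bound (t tau x : R) :
  0 <= t -> 0 <= tau -> t + tau < T -> inI rho x -> - (B * tau) <= v (t + tau) x - v t x.
Proof.
intros ht hta hT hx.
destruct (Req_dec tau 0) as [->|n]; [rewrite Rplus_0_r; lra|].
apply Rnot_lt_le; intros h.
set (eta := (- (B * tau) - (v (t + tau) x - v t x))). fold eta in h.
assert (he : 0 < eta) by (unfold eta; lra).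
destruct (proj1 (proj1 sol) t x ltac:(lra) hx (eta / 2) ltac:(lra)) as [d [hd H]].
set (s := Rmin (d / 2) (tau / 2)).
assert (s0 : 0 < s) by (unfold s; apply Rmin_pos; lra).
assert (s1 : s <= d / 2) by apply Rmin_l.
assert (s2 : s <= tau / 2) by apply Rmin_r.
specialize (H (t + s) x ltac:(lra) hx).
replace (t + s - t) with s in H by ring.
rewrite Rminus_diag, Rabs_R0, Rabs_pos_eq in H by lra.
specialize (H ltac:(lra) hd). apply Rabs_def2 in H.
destruct (MVT_cor2 (fun r => v r x) (fun r => vt r x) (t + s) (t + tau)) as [r [e hr]];
  [lra| |].
{ intros r hr. apply (proj2 (proj1 sol) r x); [lra|exact hx]. }
assert (b := vt_bound r x ltac:(lra) hx). unfold eta in *. nra.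
Qed.

Lemma solution_lower_bound (t x : R) : 0 <= t < T -> inI rho x -> - (B * T) <= v t x.
Proof.
intros ht hx. assert (h := solution_increment_bound 0 t x). rewrite Rplus_0_l, v_init in h by auto.
specialize (h ltac:(lra) ltac:(lra)). specialize (h ltac:(lra) hx). nra.
Qed.

(** Provides the initial inequality for the two-point function of [v(t + tau) - v(t)], which at
    [t = 0] is just [v(tau)]. *)
Lemma solution_incr_space (t x y : R) :
  0 <= t < T -> Rabs x <= y <= rho -> v t x <= v t y.
Proof.
intros ht hxy. destruct (abs_le_inI rho x y hxy) as [hx hy].
apply Rnot_lt_le; intros lt.
(* The zeroth-order term [- exp (-2 * v) * K] changes by at most [2 * K 0 * exp (2 * B * T)] times
   the difference of [v]; the added 1 makes the growth of the bound strictly faster. *)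
set (mu := 2 * K 0 * exp (2 * (B * T)) + 1).
assert (K0 := K_nonneg 0 (inI_0 rho rho_pos)).
assert (mu0 : 1 <= mu).
{ unfold mu. assert (p := exp_pos (2 * (B * T))). nra. }
(* With this [e] the bound at time [t] equals the assumed difference, so the strict two-point
   estimate is a contradiction. *)
set (e := (v t x - v t y) / exp (mu * t)).
assert (he : 0 < e) by (apply Rdiv_lt_0_compat; [lra|apply exp_pos]).
enough (q : v t x - v t y < e * exp (mu * t)).
{ unfold e in q. assert (p := exp_pos (mu * t)). unfold Rdiv in q.
  rewrite Rmult_assoc, Rinv_l in q by lra. lra. }
apply (two_point_max_principle rho t v vt vr vrr (fun s => e * exp (mu * s))
  (fun s => mu * (e * exp (mu * s)))); auto; try lra.
- apply regular_shrink with T; [lra|apply sol].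
- intros; apply solution_even; auto; lra.
- intros s _. apply Rmult_lt_0_compat; [exact he|apply exp_pos].
- intros s _. apply is_derive_Reals. auto_derive; [exact I|ring].
- intros p q hpq. destruct (abs_le_inI rho p q hpq) as [hp hq].
  rewrite !v_init, Rmult_0_r, exp_0 by auto. lra.
- intros s p hs hp E. destruct sol as [_ [_ [h3 _]]]. rewrite h3 by lra.
  assert (hp0 := solution_nonpos s p ltac:(lra) hp).
  assert (p0 := exp_pos (mu * s)).
  assert (exp (v s rho) < 1) by (rewrite <- exp_0; apply exp_increasing; nra). nra.
- intros s p q hs hpq E z1 z2 z3 z4.
  destruct (abs_le_inI rho p q ltac:(lra)) as [hp hq].
  destruct sol as [_ [h2 _]]. rewrite !h2 by (auto; lra). unfold speed. rewrite z1, z2.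
  assert (Y0 : 0 < e * exp (mu * s)) by (apply Rmult_lt_0_compat; [lra|apply exp_pos]).
  rewrite <- E in *. set (Y := v s p - v s q) in *.
  assert (kp := K_nonneg p hp). assert (kq := K_nonneg q hq). assert (kq0 := K_le_K0 q hq).
  assert (kpq : K q <= K p).
  { apply K_decr; auto. rewrite (Rabs_pos_eq q); [lra|]. assert (h := Rabs_pos p); lra. }
  assert (ep := exp_pos (-2 * v s p)). assert (eq := exp_pos (-2 * v s q)).
  assert (rel : exp (-2 * v s p) = exp (-2 * v s q) * exp (-2 * Y)).
  { rewrite <- exp_plus. f_equal. unfold Y. ring. }
  assert (lb := exp_ineq1_le (-2 * Y)).
  assert (ub : exp (-2 * v s q) <= exp (2 * (B * T))).
  { assert (h := solution_lower_bound s q ltac:(lra) hq).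
    destruct (Req_dec (-2 * v s q) (2 * (B * T))) as [->|n]; [lra|].
    left; apply exp_increasing; lra. }
  set (Ep := exp (-2 * v s p)) in *. set (Eq := exp (-2 * v s q)) in *.
  set (M := exp (2 * (B * T))) in *.
  assert (s1 : Ep * (vrr s p + c p * 0 - K p) <= - (Ep * K q)).
  { apply Rle_trans with (Ep * (- K q)); [apply Rmult_le_compat_l; lra|lra]. }
  assert (s2 : Eq * - K q <= Eq * (vrr s q + c q * 0 - K q))
    by (apply Rmult_le_compat_l; lra).
  assert (s3 : Eq - Ep <= M * (2 * Y)).
  { rewrite rel. apply Rle_trans with (Eq * (2 * Y)); [nra|].
    apply Rmult_le_compat_r; lra. }
  assert (s4 : (Eq - Ep) * K q <= M * (2 * Y) * K 0).
  { assert (0 <= M * (2 * Y)) by (apply Rmult_le_pos; lra).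
    apply Rle_trans with (M * (2 * Y) * K q); [apply Rmult_le_compat_r; lra|].
    apply Rmult_le_compat_l; lra. }
  unfold mu. fold M. lra.
Qed.

(* One step of a bootstrap: the quantity to be bounded is, up to a factor, the
   derivative at [tau = 0] of the two-point function of [v(t + tau) - v(t)], and
   it enters the evolution of that function only through its time integral. *)
Lemma vt_oscillation_halve (b : R) :
  0 < b ->
  (forall t x y, 0 < t < T -> Rabs x <= y <= rho ->
     vt t x - vt t y <= b * exp ((18 * B + 1) * t)) ->
  forall t x y, 0 < t < T -> Rabs x <= y <= rho ->
     vt t x - vt t y <= b / 2 * exp ((18 * B + 1) * t).
Proof.
intros hb Hb t x y ht hxy. destruct (abs_le_inI rho x y hxy) as [hx hy].
set (mu := 18 * B + 1) in *.
assert (pB : 0 < / (2 * B)) by (apply Rinv_0_lt_compat; lra).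
assert (qB : 2 * B * / (2 * B) = 1) by (field; lra).
(* The second bound gives [2 * B * tau <= 1], so the exponentials of the increments below are at
   most [1 + 6 * B * tau] and 3. The first keeps [t + tau] below [T]. *)
set (t1 := Rmin ((T - t) / 2) (/ (2 * B))).
assert (t1pos : 0 < t1) by (unfold t1; apply Rmin_pos; lra).
assert (t1a : t1 <= (T - t) / 2) by apply Rmin_l.
assert (t1b : t1 <= / (2 * B)) by apply Rmin_r.
assert (key : forall tau, 0 < tau <= t1 ->
   (v (t + tau) x - v t x) - (v (t + tau) y - v t y) < tau * (b / 2) * exp (mu * t)).
{ intros tau hta.
  assert (small : 0 <= 2 * (B * tau) <= 1) by nra.
  assert (solt : solution t v vt vr vrr) by (apply solution_shrink with T; [lra|exact sol]).
  assert (solta : solution t (fun s => v (s + tau)) (fun s => vt (s + tau))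
             (fun s => vr (s + tau)) (fun s => vrr (s + tau))).
  { apply solution_shrink with (T - tau); [lra|]. apply solution_shift; [lra|exact sol]. }
  assert (reg := regular_minus _ _ _ _ _ _ _ _ _ _ (proj1 solta) (proj1 solt)).
  apply (two_point_max_principle rho t _ _ _ _ (fun s => tau * (b / 2) * exp (mu * s))
    (fun s => mu * (tau * (b / 2) * exp (mu * s))) rho_pos reg); try lra.
  - intros s p hs hp. rewrite !solution_even by (auto; lra). reflexivity.
  - intros s _. apply Rmult_lt_0_compat; [nra|apply exp_pos].
  - intros s _. apply is_derive_Reals. auto_derive; [exact I|ring].
  - intros p q hpq. destruct (abs_le_inI rho p q hpq) as [hp hq].
    rewrite Rplus_0_l, !v_init, Rmult_0_r, exp_0 by auto.
    assert (h := solution_incr_space tau p q ltac:(lra) hpq). nra.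
  - intros s p hs hp E. destruct sol as [_ [_ [h3 _]]]. rewrite !h3 by lra.
    assert (hp0 := solution_decr_time s tau p ltac:(lra) ltac:(lra) ltac:(lra) hp).
    assert (p0 : 0 < tau * (b / 2) * exp (mu * s))
      by (apply Rmult_lt_0_compat; [nra|apply exp_pos]).
    assert (exp (v (s + tau) rho) < exp (v s rho)) by (apply exp_increasing; lra). nra.
  - intros s p q hs hpq E z1 z2 z3 z4.
    destruct (abs_le_inI rho p q ltac:(lra)) as [hp hq].
    assert (osc := Hb s p q ltac:(lra) ltac:(lra)).
    assert (Bq := vt_bound s q ltac:(lra) hq).
    assert (nq := solution_vt_nonpos s q ltac:(lra) hq).
    assert (np := solution_vt_nonpos s p ltac:(lra) hp).
    assert (incp := solution_increment_bound s tau p ltac:(lra) ltac:(lra) ltac:(lra) hp).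
    assert (incq := solution_increment_bound s tau q ltac:(lra) ltac:(lra) ltac:(lra) hq).
    assert (decp := solution_decr_time s tau p ltac:(lra) ltac:(lra) ltac:(lra) hp).
    assert (decq := solution_decr_time s tau q ltac:(lra) ltac:(lra) ltac:(lra) hq).
    destruct sol as [_ [h2 _]].
    rewrite (h2 (s + tau) p), (h2 (s + tau) q) by (auto; lra).
    unfold speed.
    assert (ep := h2 s p ltac:(lra) hp). assert (eq := h2 s q ltac:(lra) hq).
    unfold speed in ep, eq.
    replace (vr (s + tau) p) with (vr s p) by lra.
    replace (vr (s + tau) q) with (vr s q) by lra.
    set (Y := tau * (b / 2) * exp (mu * s)) in *.
    assert (Y0 : 0 < Y) by (unfold Y; apply Rmult_lt_0_compat; [nra|apply exp_pos]).
    set (dp := v (s + tau) p - v s p) in *. set (dq := v (s + tau) q - v s q) in *.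
    assert (dp0 : dp <= 0) by (unfold dp; lra). assert (dq0 : dq <= 0) by (unfold dq; lra).
    replace (-2 * v (s + tau) p) with (-2 * v s p + -2 * dp) by (unfold dp; ring).
    replace (-2 * v (s + tau) q) with (-2 * v s q + -2 * dq) by (unfold dq; ring).
    rewrite !exp_plus.
    assert (pos1 := exp_pos (-2 * v s p)). assert (pos2 := exp_pos (-2 * v s q)).
    assert (pos3 := exp_pos (-2 * dp)). assert (pos4 := exp_pos (-2 * dq)).
    assert (up : exp (-2 * dp) <= 1 + 6 * (B * tau)).
    { apply Rle_trans with (1 + 3 * (-2 * dp)); [apply exp_le_1_plus_triple|]; lra. }
    assert (lp := exp_ineq1_le (-2 * dp)).
    assert (uq : exp (-2 * dq) <= 3).
    { apply Rle_trans with (exp 1); [|apply exp_le_3].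
      destruct (Req_dec (-2 * dq) 1) as [->|n]; [lra|]. left; apply exp_increasing; lra. }
    assert (rel : exp (-2 * dp) = exp (-2 * dq) * exp (-2 * Y)).
    { rewrite <- exp_plus. f_equal. lra. }
    assert (lY := exp_ineq1_le (-2 * Y)).
    set (Fp := exp (-2 * dp)) in *. set (Fq := exp (-2 * dq)) in *.
    set (Ep := exp (-2 * v s p)) in *. set (Eq := exp (-2 * v s q)) in *.
    (* At the touching pair [vrr] at time [s + tau] is replaced by [vrr] at time [s], which
       reproduces [vt s] with factors [Fp], [Fq]. What remains is [(Fp - 1) * (vt s p - vt s q) +
       (Fq - Fp) * - vt s q]. The two terms are at most [12 * B * Y] and [6 * B * Y], whence the
       exponent [18 * B + 1]. *)
    assert (s1 : Ep * Fp * (vrr (s + tau) p + c p * vr s p - K p) <= Fp * vt s p).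
    { rewrite ep. replace (Fp * (Ep * (vrr s p + c p * vr s p - K p)))
        with (Ep * Fp * (vrr s p + c p * vr s p - K p)) by ring.
      apply Rmult_le_compat_l; [apply Rmult_le_pos; lra|lra]. }
    assert (s2 : Fq * vt s q <= Eq * Fq * (vrr (s + tau) q + c q * vr s q - K q)).
    { rewrite eq. replace (Fq * (Eq * (vrr s q + c q * vr s q - K q)))
        with (Eq * Fq * (vrr s q + c q * vr s q - K q)) by ring.
      apply Rmult_le_compat_l; [apply Rmult_le_pos; lra|lra]. }
    set (X := b * exp (mu * s)) in *.
    assert (YX : Y = tau * X / 2) by (unfold Y, X; field).
    assert (X0 : 0 < X) by (unfold X; apply Rmult_lt_0_compat; [lra|apply exp_pos]).
    assert (s3 : (Fp - 1) * (vt s p - vt s q) <= 6 * (B * tau) * X).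
    { apply Rle_trans with ((Fp - 1) * X); [apply Rmult_le_compat_l; lra|].
      apply Rmult_le_compat_r; lra. }
    assert (s4 : Fq - Fp <= 6 * Y).
    { rewrite rel. apply Rle_trans with (Fq * (2 * Y)); [nra|].
      apply Rle_trans with (3 * (2 * Y)); [apply Rmult_le_compat_r; lra|lra]. }
    assert (s5 : (Fq - Fp) * - vt s q <= 6 * Y * B).
    { apply Rle_trans with (6 * Y * - vt s q); [apply Rmult_le_compat_r; lra|].
      apply Rmult_le_compat_l; lra. }
    assert (s6 : 6 * (B * tau) * X = 12 * B * Y) by (rewrite YX; field).
    unfold mu. lra. }
assert (Dx : derivable_pt_lim (fun tau => v (t + tau) x) 0 (vt t x * 1)).
{ apply (derivable_pt_lim_comp (fun tau => t + tau) (fun s => v s x)).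
  - apply is_derive_Reals. auto_derive; [exact I|ring].
  - rewrite Rplus_0_r. apply (proj2 (proj1 sol)); [lra|exact hx]. }
assert (Dy : derivable_pt_lim (fun tau => v (t + tau) y) 0 (vt t y * 1)).
{ apply (derivable_pt_lim_comp (fun tau => t + tau) (fun s => v s y)).
  - apply is_derive_Reals. auto_derive; [exact I|ring].
  - rewrite Rplus_0_r. apply (proj2 (proj1 sol)); [lra|exact hy]. }
assert (DY : derivable_pt_lim (fun tau => tau * (b / 2) * exp (mu * t)) 0
               (b / 2 * exp (mu * t))).
{ apply is_derive_Reals. auto_derive; [exact I|ring]. }
assert (Q := derivable_pt_lim_minus _ _ _ _ _ (derivable_pt_lim_minus _ _ _ _ _ Dx Dy) DY).
assert (q := derive_at_right_max _ t1 0 _ Q t1pos). unfold minus_fct in q.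
enough (vt t x * 1 - vt t y * 1 - b / 2 * exp (mu * t) <= 0) by lra.
apply q. intros tau hta. destruct (Req_dec tau 0) as [->|n]; [lra|].
specialize (key tau ltac:(lra)). rewrite (Rplus_0_r t). lra.
Qed.

(** Starting from the trivial bound [B], since [vt] lies between [- B] and 0, repeated halving
    drives the oscillation to 0. In terms of curvature: it stays decreasing from the middle. *)
Lemma solution_vt_incr_space (t x y : R) :
  0 < t < T -> Rabs x <= y <= rho -> vt t x <= vt t y.
Proof.
intros ht hxy.
assert (H : forall n t x y, 0 < t < T -> Rabs x <= y <= rho ->
   vt t x - vt t y <= B * (/ 2) ^ n * exp ((18 * B + 1) * t)).
{ induction n as [|n IH].
  - intros s p q hs hpq. destruct (abs_le_inI rho p q hpq) as [hp hq].
    assert (h1 := vt_bound s q hs hq). assert (h2 := solution_vt_nonpos s p ltac:(lra) hp).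
    assert (h3 := exp_ineq1_le ((18 * B + 1) * s)). simpl. nra.
  - replace (B * (/ 2) ^ S n) with (B * (/ 2) ^ n / 2) by (simpl; field).
    apply vt_oscillation_halve; [|exact IH].
    apply Rmult_lt_0_compat; [exact B_pos|apply pow_lt; lra]. }
apply Rnot_lt_le; intros lt.
set (M := B * exp ((18 * B + 1) * t)).
assert (M0 : 0 < M) by (apply Rmult_lt_0_compat; [exact B_pos|apply exp_pos]).
destruct (pow_lt_1_zero (/ 2) ltac:(rewrite Rabs_pos_eq; lra) ((vt t x - vt t y) / M))
  as [N HN]; [apply Rdiv_lt_0_compat; lra|].
specialize (HN N (le_n N)). assert (hN : 0 < (/ 2) ^ N) by (apply pow_lt; lra).
rewrite Rabs_pos_eq in HN by lra.
specialize (H N t x y ht hxy).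
apply (Rmult_lt_compat_r M) in HN; [|exact M0].
unfold Rdiv in HN. rewrite Rmult_assoc, Rinv_l in HN by lra.
unfold M in HN. lra.
Qed.

End InitialValueZero.

End UnnormalisedFlow.

(** * The normalised flow *)

(** With [psi] equal to phi, [th] is the unnormalised time as a function of the normalised one, the
    integral of [1/phi], and [S] is its inverse. *)
Lemma time_change (psi : R -> R) (b : R) :
  0 < b -> continuity psi -> (forall t, 0 < psi t) ->
  exists th S : R -> R,
    th 0 = 0 /\
    (forall s t, s < t -> th s < th t) /\
    (forall t, 0 <= t <= b -> S (th t) = t) /\
    (forall y, 0 <= y <= th b ->
       0 <= S y <= b /\ th (S y) = y /\ derivable_pt_lim S y (psi (S y))).
Proof.
intros hb cpsi psipos.
set (h := fun t => / psi t).
assert (hpos : forall t, 0 < h t) by (intros; apply Rinv_0_lt_compat, psipos).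
assert (ch : forall t, continuous h t).
{ intros t. apply continuity_pt_filterlim. apply continuity_pt_inv; [apply cpsi|].
  specialize (psipos t); lra. }
set (th := fun t => RInt h 0 t).
assert (dth : forall t, derivable_pt_lim th t (h t)).
{ intros t. apply is_derive_Reals. apply (is_derive_RInt h th 0 t); [|apply ch].
  apply filter_forall. intros x. apply (RInt_correct h). apply ex_RInt_continuous.
  intros; apply ch. }
assert (cth : forall t, continuity_pt th t)
  by (intros t; apply derivable_continuous_pt; exists (h t); apply dth).
assert (th0 : th 0 = 0) by (unfold th; rewrite RInt_point; reflexivity).
assert (incr : forall s t, s < t -> th s < th t).
{ intros s t st. destruct (MVT_cor2 th h s t st) as [c [e _]]; [intros; apply dth|].
  specialize (hpos c). nra. }
assert (inj : forall s t, th s = th t -> s = t).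
{ intros s t e. destruct (Rtotal_order s t) as [l|[l|l]]; [|exact l|];
    apply incr in l; lra. }
(* Inverting on an interval larger by 1 at each end makes the derivative of [S] two-sided at both
   ends of [[0, th b]]. *)
assert (ex : forall y, exists x, th (-1) <= y <= th (b + 1) -> -1 <= x <= b + 1 /\ th x = y).
{ intros y. destruct (classic (th (-1) <= y <= th (b + 1))) as [hy|n]; [|exists 0; tauto].
  destruct (f_interv_is_interv th (-1) (b + 1) y) as [x hx]; [lra|exact hy|auto|].
  exists x; intros _; exact hx. }
set (S := fun y => proj1_sig (constructive_indefinite_description _ (ex y))).
assert (HS : forall y, th (-1) <= y <= th (b + 1) -> -1 <= S y <= b + 1 /\ th (S y) = y)
  by (intros y; exact (proj2_sig (constructive_indefinite_description _ (ex y)))).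
assert (m1 := incr (-1) 0 ltac:(lra)). assert (m2 := incr 0 b hb).
assert (m3 := incr b (b + 1) ltac:(lra)).
exists th, S. split; [exact th0|]. split; [exact incr|]. split.
- intros t ht. apply inj. apply HS. destruct (Req_dec t 0) as [->|n]; [lra|].
  assert (a := incr 0 t ltac:(lra)). destruct (Req_dec t b) as [->|n']; [lra|].
  assert (a' := incr t b ltac:(lra)). lra.
- intros y hy. destruct (HS y ltac:(lra)) as [h1 h2]. repeat split.
  + apply Rnot_lt_le; intros l; apply incr in l; lra.
  + apply Rnot_lt_le; intros l; apply incr in l; lra.
  + exact h2.
  + assert (cS : continuity_pt S y).
    { apply (continuity_pt_recip_interv th S (-1) (b + 1)); [lra| | | |auto|lra].
      - intros; apply incr; assumption.
      - intros x l1 l2. apply (HS x); lra.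
      - intros x l1 l2. apply (HS x); lra. }
    assert (Prf : forall a : R, S (th (-1)) <= a <= S (th (b + 1)) -> derivable_pt th a)
      by (intros a _; exists (h a); apply dth).
    assert (Sl : S (th (-1)) = -1) by (apply inj, HS; lra).
    assert (Sr : S (th (b + 1)) = b + 1) by (apply inj, HS; lra).
    assert (Prg : S (th (-1)) <= S y <= S (th (b + 1))) by (rewrite Sl, Sr; exact h1).
    assert (dv : derive_pt th (S y) (Prf (S y) Prg) = h (S y)).
    { apply derive_pt_eq_0, dth. }
    assert (q := derivable_pt_lim_recip_interv th S (th (-1)) (th (b + 1)) y Prf cS
      ltac:(lra) ltac:(lra) Prg).
    rewrite dv in q. specialize (hpos (S y)). specialize (psipos (S y)).
    replace (psi (S y)) with (1 / h (S y)) by (unfold h; field; lra).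
    apply q; [|lra]. intros x hx. apply (HS x hx).
Qed.

Lemma bounded_on_rectangle (F : R -> R -> R) (t0 t1 rho : R) :
  (forall t r, t0 <= t -> cont2 F t r) ->
  exists M, 0 < M /\
    forall t r, t0 <= t <= t1 -> inI rho r -> Rabs (F t r) <= M.
Proof.
intros C.
set (a := Rmax (Rmax t1 (- t0)) rho).
assert (a1 : t1 <= a) by (unfold a; eapply Rle_trans; [apply Rmax_l|apply Rmax_l]).
assert (a2 : - t0 <= a) by (unfold a; eapply Rle_trans; [apply Rmax_r|apply Rmax_l]).
assert (a3 : rho <= a) by apply Rmax_r.
(* The product with [Rabs s] turns local boundedness of [F] into a property near [s = 0]; a uniform
   neighbourhood of radius [del] then yields the bound [2 / del]. *)
destruct (tube_2d a (fun s t r => t0 <= t -> Rabs s * Rabs (F t r) <= 1)) as [del [hd H]].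
{ intros t r. destruct (Rlt_or_le t t0) as [l|l].
  - exists (t0 - t); split; [lra|]. intros s t' r' _ ht _ l'. apply Rabs_def2 in ht. lra.
  - destruct (C t r l 1 ltac:(lra)) as [d [hd H]].
    assert (p := Rabs_pos (F t r)).
    assert (q : 0 < / (Rabs (F t r) + 1)) by (apply Rinv_0_lt_compat; lra).
    exists (Rmin d (/ (Rabs (F t r) + 1))); split; [apply Rmin_pos; lra|].
    assert (b1 := Rmin_l d (/ (Rabs (F t r) + 1))).
    assert (b2 := Rmin_r d (/ (Rabs (F t r) + 1))).
    intros s t' r' hs ht hr _. specialize (H t' r' ltac:(lra) ltac:(lra)).
    assert (tri := Rabs_triang_inv (F t' r') (F t r)).
    assert (i : / (Rabs (F t r) + 1) * (Rabs (F t r) + 1) = 1) by (field; lra).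
    assert (ps := Rabs_pos s). assert (pF := Rabs_pos (F t' r')).
    apply Rle_trans with (/ (Rabs (F t r) + 1) * (Rabs (F t r) + 1)); [|lra].
    apply Rmult_le_compat; lra. }
exists (2 / del); split; [apply Rdiv_lt_0_compat; lra|].
intros t r ht hr. unfold inI in hr.
specialize (H (del / 2) t r). rewrite (Rabs_pos_eq (del / 2)) in H by lra.
specialize (H ltac:(lra) ltac:(lra) ltac:(lra) ltac:(lra)).
apply Rmult_le_reg_l with (del / 2); [lra|].
replace (del / 2 * (2 / del)) with 1 by (field; lra). exact H.
Qed.

Lemma exp_opp_half_ln (x : R) : 0 < x -> exp (- / 2 * ln x) = / sqrt x.
Proof.
intros h. replace (- / 2 * ln x) with (- (/ 2 * ln x)) by ring.
rewrite exp_Ropp. f_equal. exact (Rpower_sqrt x h).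
Qed.

Lemma antiderivative_unique (F G g : R -> R) (a b : R) :
  a < b ->
  (forall x, a <= x <= b -> derivable_pt_lim F x (g x)) ->
  (forall x, a <= x <= b -> derivable_pt_lim G x (g x)) ->
  F b - F a = G b - G a.
Proof.
intros ab DF DG.
destruct (MVT_cor2 (fun x => F x - G x) (fun x => g x - g x) a b ab) as [x [e _]].
{ intros x hx. exact (derivable_pt_lim_minus _ _ _ _ _ (DF x hx) (DG x hx)). }
lra.
Qed.

Section NormalisedFlow.

Variables (rho : R) (df : nat -> R -> R) (u : R -> R -> R)
  (Du : nat -> nat -> R -> R -> R) (rbar phi : R -> R).

Local Notation f := (df 0%nat).
Local Notation f1 := (df 1%nat).
Local Notation f2 := (df 2%nat).
Local Notation ut := (Du 1%nat 0%nat).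
Local Notation ur := (Du 0%nat 1%nat).
Local Notation urr := (Du 0%nat 2%nat).

Definition Rscal (t r : R) : R :=
  scal_conf (df 0%nat) (df 1%nat) (df 2%nat)
    (u t r) (Du 0%nat 1%nat t r) (Du 0%nat 2%nat t r) r.
Let cc (x : R) : R := f1 x / f x.
Let KK (x : R) : R := - (f2 x / f x).
Let k0 : R := f1 rho / f rho.

Hypothesis rho_pos : 0 < rho.
Hypothesis df_smooth : smooth1 df.
Hypothesis f_pos : forall r, inI rho r -> 0 < f r.
Hypothesis R0_nonneg : forall r, inI rho r -> 0 <= scal_conf f f1 f2 0 0 0 r.
Hypothesis k0_right : geod_conf 1 f f1 0 0 rho <= 0.
Hypothesis f_even : forall r, inI rho r -> f (- r) = f r.
Hypothesis R0_decr : forall r s, inI rho r -> inI rho s -> Rabs r <= Rabs s ->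
  scal_conf f f1 f2 0 0 0 s <= scal_conf f f1 f2 0 0 0 r.
Hypothesis Du_u : Du 0%nat 0%nat = u.
Hypothesis Du_smooth : smooth2_pos Du.
Hypothesis u_init : forall r, inI rho r -> u 0 r = 0.
Hypothesis u_init_cont : forall r, inI rho r -> forall eps, 0 < eps ->
  exists delta, 0 < delta /\
    forall t x, 0 <= t < delta -> Rabs (x - r) < delta -> inI rho x -> Rabs (u t x) < eps.
Hypothesis area : forall t, 0 < t ->
  is_integral (fun x => 2 * PI * exp (2 * u t x) * f x) (- rho) rho 1.
Hypothesis rbar_integral : forall t, 0 < t ->
  is_integral (fun x => 2 * PI * Rscal t x * exp (2 * u t x) * f x) (- rho) rho (rbar t).
Hypothesis flow : forall t r, 0 < t -> inI rho r -> 2 * ut t r = rbar t - Rscal t r.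
Hypothesis phi_0 : phi 0 = 1.
Hypothesis phi_cont_0 : forall eps, 0 < eps -> exists delta, 0 < delta /\
  forall t, 0 < t < delta -> Rabs (phi t - 1) < eps.
Hypothesis phi_ode : forall t, 0 < t -> 0 < phi t /\ derivable_pt_lim phi t (rbar t * phi t).
Hypothesis boundary : forall t, 0 < t ->
  geod_conf 1 f f1 (u t rho) (ur t rho) rho = geod_conf 1 f f1 0 0 rho / sqrt (phi t) /\
  geod_conf (-1) f f1 (u t (- rho)) (ur t (- rho)) (- rho)
    = geod_conf (-1) f f1 0 0 (- rho) / sqrt (phi t).

(** * Curvature and boundary terms of the conformal metrics *)

Lemma inI_rho : inI rho rho.
Proof. unfold inI; lra. Qed.

Lemma derive_unique_on_inI (F G : R -> R) (x l m : R) :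
  inI rho x -> derivable_pt_lim F x l -> derivable_pt_lim G x m ->
  (forall y, inI rho y -> F y = G y) -> l = m.
Proof.
intros hx DF DG H. unfold inI in *.
destruct (Req_dec x (- rho)) as [->|n].
- apply (derive_unique_right F G rho (- rho)); auto; lra.
- apply (derive_unique_left F G (- rho) x); auto; [lra|].
  intros; apply H; lra.
Qed.

Lemma f1_odd (x : R) : inI rho x -> f1 (- x) = - f1 x.
Proof.
intros hx. enough (- f1 (- x) = f1 x) by lra.
apply (derive_unique_on_inI (fun y => f (- y)) f x); [exact hx| |apply df_smooth|exact f_even].
apply derivable_pt_lim_comp_opp, df_smooth.
Qed.

Lemma cc_odd (x : R) : inI rho x -> cc (- x) = - cc x.
Proof.
intros hx. unfold cc. rewrite f1_odd, f_even by auto. unfold Rdiv; ring.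
Qed.

Lemma scal_conf_0 (x : R) : scal_conf f f1 f2 0 0 0 x = 2 * KK x.
Proof. unfold scal_conf, KK, Rdiv. rewrite Rmult_0_r, exp_0. ring. Qed.

Lemma KK_nonneg (x : R) : inI rho x -> 0 <= KK x.
Proof. intros hx. assert (h := R0_nonneg x hx). rewrite scal_conf_0 in h. lra. Qed.

Lemma KK_decr (r s : R) : inI rho r -> inI rho s -> Rabs r <= Rabs s -> KK s <= KK r.
Proof.
intros hr hs h. assert (k := R0_decr r s hr hs h). rewrite !scal_conf_0 in k. lra.
Qed.

Lemma Rscal_speed (t x : R) : Rscal t x = -2 * speed cc KK u ur urr t x.
Proof. unfold Rscal, scal_conf, speed, cc, KK, Rdiv. ring. Qed.

Lemma geod_conf_right_0 : geod_conf 1 f f1 0 0 rho = k0.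
Proof. unfold geod_conf, k0. rewrite Ropp_0, exp_0. ring. Qed.

Lemma geod_conf_left_0 : geod_conf (-1) f f1 0 0 (- rho) = k0.
Proof.
unfold geod_conf, k0.
rewrite Ropp_0, exp_0, f1_odd, f_even by apply inI_rho. unfold Rdiv; ring.
Qed.

Lemma k0_nonpos : k0 <= 0.
Proof. rewrite <- geod_conf_right_0; exact k0_right. Qed.

Lemma ur_right (t : R) : 0 < t -> ur t rho = k0 * (exp (u t rho) / sqrt (phi t) - 1).
Proof.
intros ht. destruct (boundary t ht) as [h _]. rewrite geod_conf_right_0 in h.
unfold geod_conf in h. fold k0 in h. rewrite exp_Ropp in h.
assert (p := exp_pos (u t rho)). assert (q := sqrt_lt_R0 _ (proj1 (phi_ode t ht))).
assert (e : k0 + ur t rho = exp (u t rho) * (/ exp (u t rho) * (1 * k0 + 1 * ur t rho)))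
  by (field; lra).
rewrite h in e. replace (ur t rho) with (k0 + ur t rho - k0) by ring. rewrite e. field. lra.
Qed.

Lemma ur_left (t : R) : 0 < t ->
  - ur t (- rho) = k0 * (exp (u t (- rho)) / sqrt (phi t) - 1).
Proof.
intros ht. destruct (boundary t ht) as [_ h]. rewrite geod_conf_left_0 in h.
unfold geod_conf in h. rewrite exp_Ropp, f1_odd, f_even in h by apply inI_rho.
replace (- f1 rho / f rho) with (- k0) in h by (unfold k0, Rdiv; ring).
assert (p := exp_pos (u t (- rho))). assert (q := sqrt_lt_R0 _ (proj1 (phi_ode t ht))).
assert (e : k0 - ur t (- rho)
   = exp (u t (- rho)) * (/ exp (u t (- rho)) * (-1 * - k0 + -1 * ur t (- rho))))
  by (field; lra).
rewrite h in e. replace (- ur t (- rho)) with (k0 - ur t (- rho) - k0) by ring.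
rewrite e. field. lra.
Qed.

Lemma u_derivatives (t x : R) : 0 < t ->
  derivable_pt_lim (fun s => u s x) t (ut t x) /\
  derivable_pt_lim (u t) x (ur t x) /\
  derivable_pt_lim (ur t) x (urr t x).
Proof.
intros ht. rewrite <- Du_u. destruct (Du_smooth 0%nat 0%nat t x ht) as [_ [a b]].
destruct (Du_smooth 0%nat 1%nat t x ht) as [_ [_ c]]. auto.
Qed.

Lemma u_regular (T : R) : regular rho T u ut ur urr.
Proof.
split.
- intros t x ht hx eps he. destruct (Req_dec t 0) as [->|n].
  + destruct (u_init_cont x hx eps he) as [d [hd H]].
    exists d; split; [exact hd|]. intros s y hs hy k1 k2.
    rewrite u_init by exact hx. rewrite Rminus_0_r in *. apply H; auto.
    apply Rabs_def2 in k1. lra.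
  + destruct (Du_smooth 0%nat 0%nat t x ltac:(lra)) as [C _]. rewrite Du_u in C.
    destruct (C eps he) as [d [hd H]]. exists d; split; auto.
- intros t x ht _; apply u_derivatives; lra.
Qed.

(** The geodesic curvature of a circle of latitude times its radius e^u f, that is, e^{-u} times the
    r-derivative of that radius. It serves both Gauss-Bonnet and the monotonicity of the radius. *)
Let flux (t x : R) : R := f x * ur t x + f1 x.

Lemma flux_derivative (t x : R) : 0 < t -> inI rho x ->
  derivable_pt_lim (flux t) x (- / 2 * (Rscal t x * exp (2 * u t x) * f x)).
Proof.
intros ht hx. destruct (u_derivatives t x ht) as [_ [_ d]].
assert (q := derivable_pt_lim_plus _ _ _ _ _
  (derivable_pt_lim_mult _ _ _ _ _ (df_smooth 0%nat x) d) (df_smooth 1%nat x)).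
replace (- / 2 * (Rscal t x * exp (2 * u t x) * f x))
  with (f1 x * ur t x + f x * urr t x + f2 x); [exact q|].
rewrite Rscal_speed. unfold speed, cc, KK.
assert (p := f_pos x hx).
assert (e : exp (-2 * u t x) * exp (2 * u t x) = 1).
{ rewrite <- exp_plus, <- exp_0. f_equal. ring. }
replace (- / 2 * (-2 * (exp (-2 * u t x) * (urr t x + f1 x / f x * ur t x - - (f2 x / f x)))
    * exp (2 * u t x) * f x))
  with (exp (-2 * u t x) * exp (2 * u t x) *
         ((urr t x + f1 x / f x * ur t x - - (f2 x / f x)) * f x)) by (field; lra).
rewrite e. field. lra.
Qed.

Lemma flux_right (t : R) : 0 < t -> flux t rho = k0 * (exp (u t rho) * f rho) / sqrt (phi t).
Proof.
intros ht. unfold flux. rewrite ur_right by exact ht.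
replace (f1 rho) with (k0 * f rho)
  by (unfold k0; assert (h := f_pos rho inI_rho); field; lra).
assert (q := sqrt_lt_R0 _ (proj1 (phi_ode t ht))). field. lra.
Qed.

Lemma flux_left (t : R) : 0 < t ->
  flux t (- rho) = - (k0 * (exp (u t (- rho)) * f rho) / sqrt (phi t)).
Proof.
intros ht. unfold flux. rewrite f_even, f1_odd by apply inI_rho.
replace (ur t (- rho)) with (- - ur t (- rho)) by ring. rewrite ur_left by exact ht.
replace (f1 rho) with (k0 * f rho)
  by (unfold k0; assert (h := f_pos rho inI_rho); field; lra).
assert (q := sqrt_lt_R0 _ (proj1 (phi_ode t ht))). field. lra.
Qed.

(* Gauss-Bonnet on the annulus. *)
Lemma rbar_boundary (t : R) : 0 < t ->
  rbar t = -4 * PI * k0 * f rho * (exp (u t rho) + exp (u t (- rho))) / sqrt (phi t).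
Proof.
intros ht. destruct (rbar_integral t ht) as [F [DF e]].
assert (h := antiderivative_unique F (fun x => -4 * PI * flux t x) _ (- rho) rho ltac:(lra) DF).
rewrite <- e, h.
- rewrite flux_right, flux_left by exact ht.
  assert (q := sqrt_lt_R0 _ (proj1 (phi_ode t ht))). field. lra.
- intros x hx.
  replace (2 * PI * Rscal t x * exp (2 * u t x) * f x)
    with (-4 * PI * (- / 2 * (Rscal t x * exp (2 * u t x) * f x))) by field.
  apply derivable_pt_lim_scal. apply flux_derivative; auto.
Qed.

Lemma rbar_nonneg (t : R) : 0 < t -> 0 <= rbar t.
Proof.
intros ht. rewrite rbar_boundary by exact ht.
assert (q := sqrt_lt_R0 _ (proj1 (phi_ode t ht))). assert (p := PI_RGT_0).
assert (k := k0_nonpos). assert (h := f_pos rho inI_rho).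
assert (e1 := exp_pos (u t rho)). assert (e2 := exp_pos (u t (- rho))).
replace (-4 * PI * k0 * f rho * (exp (u t rho) + exp (u t (- rho))) / sqrt (phi t))
  with (4 * (PI * (- k0 * (f rho * ((exp (u t rho) + exp (u t (- rho))) * / sqrt (phi t))))))
  by (field; lra).
assert (i := Rinv_0_lt_compat _ q).
repeat (apply Rmult_le_pos; [lra|]). lra.
Qed.

(** * Passage to the unnormalised flow *)

Let psi (t : R) : R := if Rle_dec t 0 then 1 else phi t.

Lemma psi_phi (t : R) : 0 <= t -> psi t = phi t.
Proof.
intros ht. unfold psi. destruct (Rle_dec t 0); [|reflexivity].
replace t with 0 by lra. symmetry; exact phi_0.
Qed.

Lemma psi_pos (t : R) : 0 < psi t.
Proof.
unfold psi. destruct (Rle_dec t 0); [lra|]. apply phi_ode; lra.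
Qed.

(** [time_change] differentiates at time 0 from both sides, so [psi] continues [phi] to negative
    times by its initial value 1. *)
Lemma psi_continuity : continuity psi.
Proof.
intros t.
enough (H : forall eps, 0 < eps -> exists d, 0 < d /\
          forall s, Rabs (s - t) < d -> Rabs (psi s - psi t) < eps).
{ intros eps he. destruct (H eps he) as [d [hd k]]. exists d; split; [exact hd|].
  intros s [_ hs]. apply k; exact hs. }
intros eps he. destruct (Rtotal_order t 0) as [l|[->|l]].
- exists (- t); split; [lra|]. intros s hs. apply Rabs_def2 in hs.
  unfold psi. destruct (Rle_dec s 0), (Rle_dec t 0); try lra.
  rewrite Rminus_diag, Rabs_R0; exact he.
- destruct (phi_cont_0 eps he) as [d [hd k]]. exists d; split; [exact hd|].
  intros s hs. apply Rabs_def2 in hs. unfold psi.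
  destruct (Rle_dec 0 0); [|lra]. destruct (Rle_dec s 0).
  + rewrite Rminus_diag, Rabs_R0; exact he.
  + apply k; lra.
- destruct (derivable_pt_lim_continuous _ _ _ (proj2 (phi_ode t l)) eps he) as [d [hd k]].
  exists (Rmin d t); split; [apply Rmin_pos; lra|]. intros s hs.
  assert (a := Rmin_l d t). assert (b := Rmin_r d t).
  specialize (k s ltac:(lra)). apply Rabs_def2 in hs.
  rewrite !psi_phi by lra. exact k.
Qed.

Lemma psi_derivative (t : R) : 0 < t -> derivable_pt_lim psi t (rbar t * psi t).
Proof.
intros ht. rewrite psi_phi by lra. intros eps he.
destruct (proj2 (phi_ode t ht) eps he) as [d k].
assert (hd := cond_pos d).
assert (m : 0 < Rmin d t) by (apply Rmin_pos; lra).
exists (mkposreal _ m). simpl. intros h hn hh.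
assert (a := Rmin_l d t). assert (b := Rmin_r d t).
specialize (k h hn ltac:(lra)). apply Rabs_def2 in hh as hh'.
rewrite !psi_phi by lra. exact k.
Qed.

(** g~ = g / phi has conformal exponent [u - ln phi / 2]. Subtracting this function of time removes
    [rbar] from the equation and [sqrt phi] from the boundary condition. *)
Lemma unnormalised_solution (b : R) (S : R -> R) (T : R) :
  S 0 = 0 -> (forall y, 0 < y <= T -> 0 < S y) ->
  (forall y, 0 <= y <= T -> 0 <= S y <= b /\ derivable_pt_lim S y (psi (S y))) ->
  solution rho k0 cc KK T
    (fun y x => u (S y) x + - / 2 * ln (psi (S y)))
    (fun y x => ut (S y) x * psi (S y) + - / 2 * (rbar (S y) * psi (S y)))
    (fun y => ur (S y)) (fun y => urr (S y)).
Proof.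
intros S0 Spos HS.
assert (expg : forall y, exp (- / 2 * ln (psi (S y))) = / sqrt (psi (S y)))
  by (intros; apply exp_opp_half_ln, psi_pos).
split; [|repeat split].
- apply (regular_reparam rho b T u ut ur urr S (fun y => psi (S y))
    (fun y => - / 2 * ln (psi (S y)))).
  + apply u_regular.
  + apply derivable_cont_seg with (fun y => psi (S y)). apply HS.
  + apply continuity_cont_seg. intros y hy.
    apply (continuity_pt_scal (fun y => ln (psi (S y)))).
    apply (continuity_pt_comp S (fun s => ln (psi s))).
    { apply derivable_continuous_pt. exists (psi (S y)). apply HS, hy. }
    apply (continuity_pt_comp psi ln); [apply psi_continuity|].
    apply derivable_continuous_pt. exists (/ psi (S y)). apply derivable_pt_lim_ln, psi_pos.
  + apply HS.
  + exact Spos.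
  + intros y hy. apply HS; lra.
  + intros y hy. assert (p := psi_pos (S y)).
    assert (dS := proj2 (HS y ltac:(lra))).
    assert (dp := psi_derivative (S y) (Spos y hy)).
    assert (q := derivable_pt_lim_scal _ (- / 2) _ _
      (derivable_pt_lim_comp _ _ _ _ _
        (derivable_pt_lim_comp _ _ _ _ _ dS dp) (derivable_pt_lim_ln _ p))).
    replace (rbar (S y) * psi (S y)) with (/ psi (S y) * (rbar (S y) * psi (S y) * psi (S y)))
      by (field; lra).
    exact q.
- intros y x hy hx. assert (p := psi_pos (S y)). assert (hS := Spos y hy).
  assert (fl := flow (S y) x hS hx). rewrite Rscal_speed in fl. unfold speed in *.
  replace (-2 * (u (S y) x + - / 2 * ln (psi (S y))))
    with (-2 * u (S y) x + ln (psi (S y))) by field.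
  rewrite exp_plus, exp_ln by exact p.
  replace (ut (S y) x) with (/ 2 * (2 * ut (S y) x)) by field. rewrite fl. field.
- intros y hy. rewrite ur_right by (apply Spos, hy).
  rewrite exp_plus, expg, psi_phi by (left; apply Spos, hy). reflexivity.
- intros y hy. rewrite ur_left by (apply Spos, hy).
  rewrite exp_plus, expg, psi_phi by (left; apply Spos, hy). reflexivity.
Qed.

Lemma curvature_structure (t : R) : k0 < 0 -> 0 < t ->
  (forall x, inI rho x -> 0 <= Rscal t x) /\
  (forall x y, Rabs x <= y <= rho -> Rscal t y <= Rscal t x) /\
  (forall x, inI rho x -> u t (- x) = u t x).
Proof.
(* One unit of extra time puts [th t] inside the open interval on which [vt] is bounded. *)
intros hk ht. set (b := t + 1).
destruct (time_change psi b ltac:(unfold b; lra) psi_continuity psi_pos)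
  as [th [S [th0 [thinc [Sth HS]]]]].
assert (S0 : S 0 = 0) by (rewrite <- th0 at 1; apply Sth; unfold b; lra).
set (T := th b).
assert (thy : 0 < th t < T) by (split; [rewrite <- th0|]; apply thinc; unfold b; lra).
assert (Spos : forall y, 0 < y <= T -> 0 < S y).
{ intros y hy. destruct (HS y ltac:(unfold T in *; lra)) as [[[h|h] _] [e _]]; [exact h|].
  rewrite <- h, th0 in e. lra. }
assert (Smono : forall y z, 0 <= y <= T -> 0 <= z <= T -> y <= z -> S y <= S z).
{ intros y z hy hz yz. apply Rnot_lt_le; intros l. apply thinc in l.
  destruct (HS y hy) as [_ [e _]], (HS z hz) as [_ [e' _]]. lra. }
assert (sol := unnormalised_solution b S T S0 Spos
  (fun y hy => let H := HS y hy in conj (proj1 H) (proj2 (proj2 H)))).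
set (v := fun y x => u (S y) x + - / 2 * ln (psi (S y))) in sol.
set (vt := fun y x => ut (S y) x * psi (S y) + - / 2 * (rbar (S y) * psi (S y))) in sol.
assert (v_init : forall x, inI rho x -> v 0 x = 0).
{ intros x hx. unfold v. rewrite S0, u_init, psi_phi, phi_0, ln_1 by (auto; lra). ring. }
assert (vneg := solution_nonpos rho k0 cc KK rho_pos hk KK_nonneg T v _ _ _ sol v_init).
assert (vtR : forall y x, 0 < y <= T -> inI rho x -> vt y x = - / 2 * psi (S y) * Rscal (S y) x).
{ intros y x hy hx. unfold vt. assert (fl := flow (S y) x (Spos y hy) hx).
  replace (ut (S y) x) with (/ 2 * (2 * ut (S y) x)) by field. rewrite fl. field. }
(* Smoothness bounds [vt] only away from time 0, so the interval is cut at [del]: up to it the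
   scaling bound applies, after it compactness controls [ut] and Gauss-Bonnet controls [rbar]. *)
assert (bound : exists B, 0 < B /\ forall y x, 0 < y < T -> inI rho x -> - B <= vt y x).
{ set (C := 3 * KK 0 + 1).
  assert (KK0 := KK_nonneg 0 (inI_0 rho rho_pos)).
  assert (hC : 0 < / (4 * C)) by (apply Rinv_0_lt_compat; unfold C; lra).
  assert (eC : 4 * C * / (4 * C) = 1) by (field; unfold C; lra).
  set (del := Rmin (/ (4 * C)) (T / 2)).
  assert (d0 : 0 < del) by (unfold del; apply Rmin_pos; lra).
  assert (d1 : del <= / (4 * C)) by apply Rmin_l.
  assert (d2 : del <= T / 2) by apply Rmin_r.
  assert (Sd := Spos del ltac:(lra)).
  destruct (bounded_on_rectangle ut (S del) b rho) as [M [M0 HM]].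
  { intros s r hs. apply Du_smooth; lra. }
  destruct (continuity_ab_maj psi 0 b) as [tm [Hm _]]; [unfold b; lra|
    intros; apply psi_continuity|].
  set (Phi := psi tm) in *. assert (Phi0 : 0 < Phi) by apply psi_pos.
  assert (fr := f_pos rho inI_rho). assert (pi0 := PI_RGT_0).
  (* A bound for [rbar]: both terms [exp u / sqrt phi] of the Gauss-Bonnet formula are [exp v <= 1],
     and 8 is its factor 4 times these two. *)
  set (Cr := 8 * (PI * (- k0 * f rho))).
  assert (Cr0 : 0 < Cr) by (unfold Cr; repeat (apply Rmult_lt_0_compat; try lra)).
  exists (2 * C + (M + Cr) * Phi). split; [unfold C; nra|].
  intros y x hy hx.
  destruct (Rle_or_lt y del) as [l|l].
  { assert (h := solution_vt_bound_initial rho k0 cc KK rho_pos hk KK_nonneg KK_decr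
      T v vt _ _ sol v_init C y x ltac:(unfold C; lra) ltac:(unfold C; lra)).
    specialize (h ltac:(unfold C in *; nra) ltac:(lra) hx).
    enough (0 <= (M + Cr) * Phi) by lra. nra. }
  assert (Sy := Spos y ltac:(lra)).
  assert (Syb : S y <= b) by (apply HS; unfold T in *; lra).
  assert (hu := HM (S y) x (conj (Smono del y ltac:(lra) ltac:(lra) ltac:(lra)) Syb) hx).
  apply Rabs_le_between in hu.
  assert (hp := Hm (S y) ltac:(lra)). assert (pp := psi_pos (S y)).
  assert (hr : rbar (S y) <= Cr).
  { assert (e : forall z, inI rho z -> exp (u (S y) z) * / sqrt (phi (S y)) <= 1).
    { intros z hz. rewrite <- psi_phi, <- (exp_opp_half_ln _ pp), <- exp_plus by lra.
      specialize (vneg y z ltac:(lra) hz). unfold v in vneg.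
      rewrite <- exp_0. destruct vneg as [n|n]; [left; apply exp_increasing; exact n|].
      rewrite n; lra. }
    assert (e1 := e rho inI_rho). assert (e2 := e (- rho) (inI_opp _ _ inI_rho)).
    rewrite rbar_boundary by exact Sy. unfold Cr, Rdiv.
    set (q := / sqrt (phi (S y))) in *.
    replace (-4 * PI * k0 * f rho * (exp (u (S y) rho) + exp (u (S y) (- rho))) * q)
      with (4 * (PI * (- k0 * f rho)) *
             (exp (u (S y) rho) * q + exp (u (S y) (- rho)) * q)) by ring.
    assert (0 < PI * (- k0 * f rho)) by (repeat (apply Rmult_lt_0_compat; try lra)).
    apply Rle_trans with (4 * (PI * (- k0 * f rho)) * 2); [|lra].
    apply Rmult_le_compat_l; lra. }
  assert (hr0 := rbar_nonneg (S y) Sy).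
  unfold vt.
  assert (a1 : - M * Phi <= ut (S y) x * psi (S y)) by nra.
  assert (a2 : rbar (S y) * psi (S y) <= Cr * Phi) by (apply Rmult_le_compat; lra).
  assert (0 < Cr * Phi) by (apply Rmult_lt_0_compat; lra). unfold C. lra. }
destruct bound as [B [B0 HB]].
assert (St : S (th t) = t) by (apply Sth; unfold b; lra).
assert (pt := psi_pos t).
assert (even : forall s x, 0 < s < b -> inI rho x -> u s (- x) = u s x).
{ intros s x hs hx.
  assert (h1 := thinc 0 s ltac:(lra)). assert (h2 := thinc s b ltac:(lra)).
  assert (h := solution_even rho k0 cc KK rho_pos hk cc_odd KK_decr T v vt _ _ sol v_init
    (th s) x ltac:(unfold T; lra) hx).
  unfold v in h. rewrite Sth in h by lra. lra. }
repeat split.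
- intros x hx. assert (h := solution_vt_nonpos rho k0 cc KK rho_pos hk KK_nonneg T v vt _ _
    sol v_init (th t) x ltac:(lra) hx).
  rewrite vtR, St in h by (auto; lra). nra.
- intros x y hxy. destruct (abs_le_inI rho x y hxy) as [hx hy].
  assert (h := solution_vt_incr_space rho k0 cc KK rho_pos hk cc_odd KK_nonneg KK_decr
    T v vt _ _ sol v_init B B0 HB (th t) x y ltac:(lra) hxy).
  rewrite !vtR, St in h by (auto; lra). nra.
- intros x hx. apply even; [unfold b; lra|exact hx].
Qed.

(** * Radii of the circles of latitude and decay of the curvature *)

Lemma Rscal_le_middle (t x : R) : k0 < 0 -> 0 < t -> inI rho x -> Rscal t x <= Rscal t 0.
Proof.
intros hk ht hx.
assert (pos : forall y, 0 <= y <= rho -> Rscal t y <= Rscal t 0).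
{ intros y hy. apply (curvature_structure t hk ht). rewrite Rabs_R0. exact hy. }
unfold inI in hx. destruct (Rle_or_lt 0 x) as [h|h]; [apply pos; lra|].
enough (e : ut t (- x) = ut t x).
{ assert (h1 := flow t x ht hx). assert (h2 := flow t (- x) ht (inI_opp rho x hx)).
  specialize (pos (- x) ltac:(lra)). lra. }
apply (derive_unique_left (fun s => u s (- x)) (fun s => u s x) (t / 2) t);
  [apply u_derivatives, ht|apply u_derivatives, ht|lra|].
intros s hs. apply (curvature_structure s hk ltac:(lra)). exact hx.
Qed.

(* [expu_f] is the radius of the circle of latitude in [g(t)]. *)
Let expu_f (t x : R) : R := exp (u t x) * f x.

(** Evenness makes [flux] vanish in the middle, and [R >= 0] makes it nonincreasing, so it is
    nonpositive on [[0, rho]]. *)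
Lemma expu_f_decr (t x y : R) : k0 < 0 -> 0 < t -> 0 <= x <= y -> y <= rho ->
  expu_f t y <= expu_f t x.
Proof.
intros hk ht hxy hy. destruct (curvature_structure t hk ht) as [Rpos [_ even]].
assert (flux0 : flux t 0 = 0).
{ assert (h := f1_odd 0 (inI_0 rho rho_pos)). rewrite Ropp_0 in h.
  assert (h' : - ur t 0 = ur t 0).
  { apply (derive_unique_on_inI (fun z => u t (- z)) (u t) 0 _ _ (inI_0 rho rho_pos)).
    - apply derivable_pt_lim_comp_opp. rewrite Ropp_0. apply u_derivatives, ht.
    - apply u_derivatives, ht.
    - exact even. }
  unfold flux. replace (ur t 0) with 0 by lra. lra. }
assert (flux_neg : forall z, 0 <= z <= rho -> flux t z <= 0).
{ intros z hz. destruct (Req_dec z 0) as [->|n]; [lra|].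
  destruct (MVT_cor2 (flux t) (fun c => - / 2 * (Rscal t c * exp (2 * u t c) * f c)) 0 z)
    as [c [e hc]]; [lra|intros c hc; apply flux_derivative; unfold inI; lra|].
  assert (hc' : inI rho c) by (unfold inI; lra).
  assert (p1 := Rpos c hc'). assert (p2 := f_pos c hc'). assert (p3 := exp_pos (2 * u t c)).
  assert (0 <= Rscal t c * exp (2 * u t c) * f c) by (apply Rmult_le_pos; [apply Rmult_le_pos|]; lra).
  nra. }
destruct (Req_dec x y) as [->|n]; [lra|].
destruct (MVT_cor2 (expu_f t) (fun z => exp (u t z) * flux t z) x y ltac:(lra)) as [c [e hc]].
{ intros c hc. destruct (u_derivatives t c ht) as [_ [d _]].
  assert (q := derivable_pt_lim_mult _ _ _ _ _
    (derivable_pt_lim_comp _ _ _ _ _ d (derivable_pt_lim_exp (u t c))) (df_smooth 0%nat c)).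
  replace (exp (u t c) * flux t c) with (exp (u t c) * ur t c * f c + exp (u t c) * f1 c)
    by (unfold flux; ring).
  exact q. }
assert (h := flux_neg c ltac:(lra)). assert (p := exp_pos (u t c)).
assert (exp (u t c) * flux t c <= 0) by nra. nra.
Qed.

Lemma f_bounds : exists m M, 0 < m /\ forall x, inI rho x -> m <= f x <= M.
Proof.
assert (cf : forall x, - rho <= x <= rho -> continuity_pt f x)
  by (intros x _; apply derivable_continuous_pt; exists (f1 x); apply df_smooth).
destruct (continuity_ab_min f (- rho) rho ltac:(lra) cf) as [a [ha ia]].
destruct (continuity_ab_maj f (- rho) rho ltac:(lra) cf) as [b [hb ib]].
exists (f a), (f b); split; [apply f_pos, ia|]. intros x hx; split; [apply ha|apply hb]; exact hx.
Qed.

Lemma radius_bounds : k0 < 0 ->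
  exists C0 C1, 0 < C1 /\ forall t, 0 < t -> - C0 <= u t 0 /\ expu_f t rho <= C1.
Proof.
intros hk. destruct f_bounds as [m [M [m0 Hf]]].
assert (pi0 := PI_RGT_0). assert (f0 := f_pos 0 (inI_0 rho rho_pos)).
set (q := 4 * PI * rho). assert (q0 : 0 < q) by (unfold q; repeat (apply Rmult_lt_0_compat; try lra)).
set (a := m / (q * (f 0 * f 0))).
assert (a0 : 0 < a) by (apply Rdiv_lt_0_compat; [lra|repeat (apply Rmult_lt_0_compat; try lra)]).
(* The mean value theorem for the area gives a point [c] where the squared radius is [f c / q].
   Monotonicity compares it with the radius at 0, giving [a <= exp (2 * u t 0)], and at [rho], where
   a square at most [M / q] forces a value at most [1 + M / q]. *)
exists (- (/ 2 * ln a)), (1 + M / q).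
assert (HM := Hf 0 (inI_0 rho rho_pos)).
split; [assert (0 < M / q) by (apply Rdiv_lt_0_compat; lra); lra|].
intros t ht. destruct (curvature_structure t hk ht) as [_ [_ even]].
destruct (area t ht) as [F [DF e]].
destruct (MVT_cor2 F (fun x => 2 * PI * exp (2 * u t x) * f x) (- rho) rho)
  as [c [e' hc]]; [lra|exact DF|].
rewrite e in e'. assert (hc' : inI rho c) by (unfold inI; lra).
assert (fc := f_pos c hc'). assert (Hc := Hf c hc').
assert (Epos : forall z, inI rho z -> 0 < expu_f t z).
{ intros z hz. apply Rmult_lt_0_compat; [apply exp_pos|apply f_pos, hz]. }
assert (exp2 : forall z, exp (2 * u t z) = exp (u t z) * exp (u t z)).
{ intros z. rewrite <- exp_plus. f_equal. ring. }
assert (Ec : expu_f t c * expu_f t c * q = f c).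
{ unfold expu_f, q. rewrite exp2 in e'.
  replace (exp (u t c) * f c * (exp (u t c) * f c) * (4 * PI * rho))
    with (2 * PI * (exp (u t c) * exp (u t c)) * f c * (rho - - rho) * f c) by ring.
  rewrite <- e'. ring. }
assert (Eabs : expu_f t (Rabs c) = expu_f t c).
{ unfold Rabs. destruct (Rcase_abs c); [|reflexivity].
  unfold expu_f. rewrite even, f_even by exact hc'. reflexivity. }
assert (habs : 0 <= Rabs c <= rho) by (split; [apply Rabs_pos|apply Rabs_le; lra]).
assert (h1 := expu_f_decr t (Rabs c) rho hk ht ltac:(lra) ltac:(lra)).
assert (h2 := expu_f_decr t 0 (Rabs c) hk ht ltac:(lra) ltac:(lra)).
rewrite Eabs in h1, h2.
assert (pr := Epos rho inI_rho). assert (pc := Epos c hc'). assert (p0 := Epos 0 (inI_0 rho rho_pos)).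
split.
- assert (k : a <= exp (2 * u t 0)).
  { unfold a. apply Rmult_le_reg_r with (q * (f 0 * f 0)); [repeat (apply Rmult_lt_0_compat; try lra)|].
    replace (m / (q * (f 0 * f 0)) * (q * (f 0 * f 0))) with m by (field; lra).
    rewrite exp2. replace (exp (u t 0) * exp (u t 0) * (q * (f 0 * f 0)))
      with (expu_f t 0 * expu_f t 0 * q) by (unfold expu_f; ring).
    apply Rle_trans with (expu_f t c * expu_f t c * q); [lra|].
    apply Rmult_le_compat_r; [lra|]. apply Rmult_le_compat; lra. }
  enough (ln a <= 2 * u t 0) by lra.
  rewrite <- (ln_exp (2 * u t 0)). destruct k as [k|k]; [|rewrite k; lra].
  left; apply ln_increasing; assumption.
- assert (k : expu_f t rho * expu_f t rho <= M / q).
  { apply Rmult_le_reg_r with q; [exact q0|].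
    replace (M / q * q) with M by (field; lra).
    apply Rle_trans with (expu_f t c * expu_f t c * q); [|lra].
    apply Rmult_le_compat_r; [lra|]. apply Rmult_le_compat; lra. }
  nra.
Qed.

(* The derivative of [ln phi - 2 u(., 0)] is [R(., 0)], while [sqrt phi] grows at
   most linearly and [u(., 0)] is bounded below. *)
Lemma middle_curvature_small (eps N : R) : k0 < 0 -> 0 < eps ->
  exists t, N < t /\ 0 < t /\ Rscal t 0 <= eps.
Proof.
intros hk he. apply NNPP; intros no.
assert (big : forall t, N < t -> 0 < t -> eps < Rscal t 0).
{ intros t h1 h2. apply Rnot_le_lt; intros h3. apply no. exists t; auto. }
destruct (radius_bounds hk) as [C0 [C1 [C1pos HC]]].
set (a := Rmax N 0 + 1).
assert (aN : N < a) by (unfold a; assert (h := Rmax_l N 0); lra).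
assert (a0 : 0 < a) by (unfold a; assert (h := Rmax_r N 0); lra).
assert (pi0 := PI_RGT_0).
set (C := 4 * (PI * (- k0 * C1))).
assert (Cpos : 0 < C) by (unfold C; repeat (apply Rmult_lt_0_compat; try lra)).
assert (dsq : forall t, 0 < t ->
   derivable_pt_lim (fun s => sqrt (phi s)) t (/ (2 * sqrt (phi t)) * (rbar t * phi t))).
{ intros t ht. destruct (phi_ode t ht) as [p d].
  exact (derivable_pt_lim_comp _ _ _ _ _ d (derivable_pt_lim_sqrt _ p)). }
(* The square root is the right power of [phi]: the [1 / sqrt phi] in [rbar] cancels, leaving a
   multiple of the boundary radius. *)
assert (dsq_bound : forall t, 0 < t -> / (2 * sqrt (phi t)) * (rbar t * phi t) <= C).
{ intros t ht. destruct (phi_ode t ht) as [p _]. assert (sp := sqrt_lt_R0 _ p).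
  rewrite rbar_boundary by exact ht.
  destruct (curvature_structure t hk ht) as [_ [_ even]].
  rewrite (even rho inI_rho). rewrite <- (sqrt_sqrt (phi t)) at 3 by lra.
  replace (/ (2 * sqrt (phi t)) *
     (-4 * PI * k0 * f rho * (exp (u t rho) + exp (u t rho)) / sqrt (phi t) *
     (sqrt (phi t) * sqrt (phi t))))
    with (4 * (PI * (- k0 * expu_f t rho))) by (unfold expu_f; field; lra).
  unfold C. apply Rmult_le_compat_l; [lra|]. apply Rmult_le_compat_l; [lra|].
  apply Rmult_le_compat_l; [lra|]. apply HC, ht. }
assert (dG : forall t, 0 < t ->
   derivable_pt_lim (fun s => ln (phi s) - 2 * u s 0) t (Rscal t 0)).
{ intros t ht. destruct (phi_ode t ht) as [p d].
  assert (q := derivable_pt_lim_minus _ _ _ _ _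
    (derivable_pt_lim_comp _ _ _ _ _ d (derivable_pt_lim_ln _ p))
    (derivable_pt_lim_scal _ 2 _ _ (proj1 (u_derivatives t 0 ht)))).
  assert (fl := flow t 0 ht (inI_0 rho rho_pos)).
  replace (Rscal t 0) with (/ phi t * (rbar t * phi t) - 2 * ut t 0)
    by (rewrite fl; field; lra).
  exact q. }
set (G := fun s => ln (phi s) - 2 * u s 0) in *.
set (h0 := sqrt (phi a)).
(* In the tangent bound [ln y <= eta * y - 1 - ln eta] this choice makes the linear growth
   [2 * eta * C * s] exactly half of [eps * s]. *)
set (eta := eps / (4 * C)).
assert (eta0 : 0 < eta) by (apply Rdiv_lt_0_compat; lra).
assert (etaC : eta * C = eps / 4) by (unfold eta; field; lra).
assert (lin : forall s, 0 < s ->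
   G a + eps * s <= 2 * (eta * (h0 + C * s) - 1 - ln eta) + 2 * C0).
{ intros s hs.
  destruct (MVT_cor2 G (fun c => Rscal c 0) a (a + s)) as [c [e hc]];
    [lra|intros; apply dG; lra|].
  destruct (MVT_cor2 (fun s => sqrt (phi s)) (fun t => / (2 * sqrt (phi t)) * (rbar t * phi t))
    a (a + s)) as [c' [e' hc']]; [lra|intros; apply dsq; lra|].
  assert (b1 := big c ltac:(lra) ltac:(lra)). assert (b2 := dsq_bound c' ltac:(lra)).
  fold h0 in e'. replace (a + s - a) with s in e, e' by ring.
  assert (p := proj1 (phi_ode (a + s) ltac:(lra))). assert (sp := sqrt_lt_R0 _ p).
  assert (Gle : G (a + s) <= 2 * ln (sqrt (phi (a + s))) + 2 * C0).
  { unfold G. rewrite <- (sqrt_sqrt (phi (a + s))) at 1 by lra.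
    rewrite ln_mult by exact sp. destruct (HC (a + s) ltac:(lra)) as [h _]. lra. }
  set (y := sqrt (phi (a + s))) in *.
  assert (ly : ln y <= eta * y - 1 - ln eta).
  { assert (h := exp_ineq1_le (ln (eta * y))).
    rewrite exp_ln in h by (apply Rmult_lt_0_compat; assumption).
    rewrite ln_mult in h by assumption. lra. }
  assert (y <= h0 + C * s) by nra.
  assert (eta * y <= eta * (h0 + C * s)) by (apply Rmult_le_compat_l; lra).
  assert (eps * s <= Rscal c 0 * s) by (apply Rmult_le_compat_r; lra).
  lra. }
set (L := 2 * (eta * h0 - 1 - ln eta) + 2 * C0 - G a).
assert (bd : forall s, 0 < s -> eps * s <= 2 * L).
{ intros s hs. specialize (lin s hs).
  replace (eta * (h0 + C * s)) with (eta * h0 + eta * C * s) in lin by ring.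
  rewrite etaC in lin. unfold L. lra. }
assert (L0 := bd 1 ltac:(lra)).
assert (i : 0 < (2 * L + 1) / eps) by (apply Rdiv_lt_0_compat; lra).
specialize (bd _ i). replace (eps * ((2 * L + 1) / eps)) with (2 * L + 1) in bd by (field; lra).
lra.
Qed.

(** * Totally geodesic boundary *)

Section TotallyGeodesicBoundary.

Hypothesis k0_zero : k0 = 0.

(** Nonnegative curvature makes [f] concave, and its derivative vanishes at both ends. *)
Lemma f1_zero (x : R) : inI rho x -> f1 x = 0.
Proof.
assert (e1 : f1 rho = 0).
{ replace (f1 rho) with (k0 * f rho)
    by (unfold k0; field; assert (h := f_pos rho inI_rho); lra).
  rewrite k0_zero; ring. }
assert (e2 : f1 (- rho) = 0) by (rewrite f1_odd by apply inI_rho; lra).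
assert (f2neg : forall y, inI rho y -> f2 y <= 0).
{ intros y hy. assert (h := KK_nonneg y hy). assert (p := f_pos y hy). unfold KK in h.
  replace (f2 y) with (- (- (f2 y / f y) * f y)) by (field; lra).
  assert (0 <= - (f2 y / f y) * f y) by (apply Rmult_le_pos; lra). lra. }
assert (dec : forall y z, - rho <= y <= z -> z <= rho -> f1 z <= f1 y).
{ intros y z hyz hz. destruct (Req_dec y z) as [->|n]; [lra|].
  destruct (MVT_cor2 f1 f2 y z ltac:(lra) (fun c _ => df_smooth 1%nat c)) as [c [e hc]].
  assert (h := f2neg c ltac:(unfold inI; lra)). nra. }
unfold inI. intros hx.
assert (h1 := dec (- rho) x ltac:(lra) ltac:(lra)).
assert (h2 := dec x rho ltac:(lra) ltac:(lra)). lra.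
Qed.

Lemma f2_zero (x : R) : inI rho x -> f2 x = 0.
Proof.
intros hx. apply (derive_unique_on_inI f1 (fun _ => 0) x); [exact hx|apply df_smooth| |].
- apply derivable_pt_lim_const.
- exact f1_zero.
Qed.

Lemma rbar_zero (t : R) : 0 < t -> rbar t = 0.
Proof. intros ht. rewrite rbar_boundary, k0_zero by exact ht. unfold Rdiv. ring. Qed.

Lemma ut_flat (t x : R) : 0 < t -> inI rho x -> ut t x = exp (-2 * u t x) * urr t x.
Proof.
intros ht hx. assert (fl := flow t x ht hx). rewrite rbar_zero, Rscal_speed in fl by exact ht.
unfold speed, cc, KK in fl. rewrite f1_zero, f2_zero in fl by exact hx.
unfold Rdiv in fl. lra.
Qed.

(** The term [x ^ 2] gives the barrier a positive outward derivative, which makes the Neumann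
    condition on [u] strict. *)
Lemma barrier_regular (T e a : R) :
  regular rho T (fun t x => e * (1 + a * t + x ^ 2)) (fun _ _ => e * a)
    (fun _ x => e * (2 * x)) (fun _ _ => e * 2).
Proof.
assert (dt : forall x t, derivable_pt_lim (fun s => e * (1 + a * s + x ^ 2)) t (e * a)).
{ intros x t. apply is_derive_Reals. auto_derive; [exact I|ring]. }
assert (dx : forall t x, derivable_pt_lim (fun y => e * (1 + a * t + y ^ 2)) x (e * (2 * x))).
{ intros t x. apply is_derive_Reals. auto_derive; [exact I|ring]. }
split.
- intros t x _ _ eps he.
  destruct (derivable_pt_lim_continuous _ _ _ (dt 0 t) (eps / 2) ltac:(lra)) as [d1 [p1 H1]].
  destruct (derivable_pt_lim_continuous _ _ _ (dx 0 x) (eps / 2) ltac:(lra)) as [d2 [p2 H2]].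
  exists (Rmin d1 d2); split; [apply Rmin_pos; lra|]. intros s y _ _ hs hy.
  assert (b1 := Rmin_l d1 d2). assert (b2 := Rmin_r d1 d2).
  specialize (H1 s ltac:(lra)). specialize (H2 y ltac:(lra)).
  apply Rabs_def2 in H1. apply Rabs_def2 in H2. apply Rabs_def1; lra.
- intros t x _ _. repeat split; [apply dt|apply dx|].
  apply is_derive_Reals. auto_derive; [exact I|ring].
Qed.

Lemma ur_boundary_zero (t : R) : 0 < t -> ur t rho = 0 /\ ur t (- rho) = 0.
Proof.
intros ht. assert (h1 := ur_right t ht). assert (h2 := ur_left t ht).
rewrite k0_zero in h1, h2. lra.
Qed.

Lemma u_flat_nonpos (t x : R) : 0 <= t -> inI rho x -> u t x <= 0.
Proof.
intros ht hx. apply Rnot_lt_le; intros lt.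
(* At a touching point [u > 0], so [exp (-2 * u) < 1], and the time slope 3 beats the second
   derivative 2 of [x ^ 2]. *)
set (e := u t x / (1 + 3 * t + x ^ 2)).
assert (q : 0 < 1 + 3 * t + x ^ 2) by nra.
assert (he : 0 < e) by (apply Rdiv_lt_0_compat; lra).
enough (u t x - e * (1 + 3 * t + x ^ 2) < 0) by (unfold e in *; field_simplify in H; lra).
apply (max_principle rho t _ _ _ _ rho_pos
  (regular_minus _ _ _ _ _ _ _ _ _ _ (u_regular t) (barrier_regular t e 3)));
  [| | | |lra|exact hx].
- intros y hy. rewrite u_init by exact hy. nra.
- intros s y hs hy E h1 h2 h3. rewrite ut_flat in h1 by (unfold inI; lra).
  assert (pos : 0 < e * (1 + 3 * s + y ^ 2)) by (apply Rmult_lt_0_compat; nra).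
  assert (p := exp_pos (-2 * u s y)).
  assert (exp (-2 * u s y) < 1) by (rewrite <- exp_0; apply exp_increasing; lra).
  nra.
- intros s hs E h. destruct (ur_boundary_zero s ltac:(lra)) as [z _]. nra.
- intros s hs E h. destruct (ur_boundary_zero s ltac:(lra)) as [_ z]. nra.
Qed.

Lemma u_flat_nonneg (t x : R) : 0 <= t -> inI rho x -> 0 <= u t x.
Proof.
intros ht hx. apply Rnot_lt_le; intros lt.
set (q := 1 + 19 * t + rho ^ 2).
assert (q0 : 0 < q) by (unfold q; nra).
(* The cap 1 keeps [u >= -1] at a touching point, where [exp (-2 * u) <= 9]; the time slope 19 beats
   9 times the second derivative 2. *)
set (e := Rmin (- u t x) 1 / q).
assert (he : 0 < e) by (apply Rdiv_lt_0_compat; [apply Rmin_pos; lra|exact q0]).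
assert (eq : e * q = Rmin (- u t x) 1) by (unfold e; field; lra).
assert (b1 := Rmin_l (- u t x) 1). assert (b2 := Rmin_r (- u t x) 1).
assert (sq : forall y, inI rho y -> y ^ 2 <= rho ^ 2) by (unfold inI; intros; nra).
assert (R1 := regular_minus _ _ _ _ _ _ _ _ _ _ (regular_zero rho t) (u_regular t)).
enough (0 - u t x - e * (1 + 19 * t + x ^ 2) < 0).
{ assert (h := sq x hx). unfold q in *. nra. }
apply (max_principle rho t _ _ _ _ rho_pos
  (regular_minus _ _ _ _ _ _ _ _ _ _ R1 (barrier_regular t e 19)));
  [| | | |lra|exact hx].
- intros y hy. rewrite u_init by exact hy. nra.
- intros s y hs hy E h1 h2 h3. rewrite ut_flat in h1 by (unfold inI; lra).
  assert (hy2 := sq y ltac:(unfold inI; lra)).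
  assert (lo : -1 <= u s y) by (unfold q in *; nra).
  assert (p := exp_pos (-2 * u s y)).
  assert (exp (-2 * u s y) <= 9).
  { apply Rle_trans with (exp (1 + 1)).
    - destruct (Req_dec (-2 * u s y) (1 + 1)) as [->|n]; [lra|].
      left; apply exp_increasing; lra.
    - rewrite exp_plus. assert (h := exp_le_3). assert (h' := exp_pos 1). nra. }
  nra.
- intros s hs E h. destruct (ur_boundary_zero s ltac:(lra)) as [z _]. nra.
- intros s hs E h. destruct (ur_boundary_zero s ltac:(lra)) as [_ z]. nra.
Qed.

Lemma Rscal_flat (t x : R) : 0 < t -> inI rho x -> Rscal t x = 0.
Proof.
intros ht hx. assert (fl := flow t x ht hx). rewrite rbar_zero in fl by exact ht.
enough (ut t x = 0) by lra.
apply (derive_unique_left (fun s => u s x) (fun _ => 0) 0 t);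
  [apply u_derivatives, ht|apply derivable_pt_lim_const|exact ht|].
intros s hs. apply Rle_antisym; [apply u_flat_nonpos|apply u_flat_nonneg]; auto; lra.
Qed.

End TotallyGeodesicBoundary.

Lemma curvature_small_at_some_time (eps N : R) : 0 < eps ->
  exists t, N < t /\ (forall r, inI rho r -> Rscal t r <= eps) /\
    exists r, inI rho r /\ - eps <= Rscal t r.
Proof.
intros he. destruct k0_nonpos as [hk|hk].
- destruct (middle_curvature_small eps N hk he) as [t [h1 [h2 h3]]].
  exists t; split; [exact h1|split].
  + intros r hr. assert (h := Rscal_le_middle t r hk h2 hr). lra.
  + exists 0; split; [apply inI_0, rho_pos|].
    assert (h := proj1 (curvature_structure t hk h2) 0 (inI_0 rho rho_pos)). lra.
- assert (h1 := Rmax_l N 0). assert (h2 := Rmax_r N 0).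
  exists (Rmax N 0 + 1); split; [lra|split].
  + intros r hr. rewrite Rscal_flat by (auto; lra). lra.
  + exists 0; split; [apply inI_0, rho_pos|]. rewrite Rscal_flat by (auto using inI_0; lra). lra.
Qed.

End NormalisedFlow.

Theorem theorem4p6
  (rho : R) (df : nat -> R -> R)
  (u : R -> R -> R) (Du : nat -> nat -> R -> R -> R)
  (rbar phi : R -> R) :
  0 < rho ->
  (* g0 = dr^2 + f(r)^2 dtheta^2 smooth on S^1 x [-rho,rho], f = df 0 *)
  smooth1 df ->
  (forall r, inI rho r -> 0 < df 0%nat r) ->
  (* A_{g0}(M) = 1 *)
  is_integral (fun r => 2 * PI * df 0%nat r) (- rho) rho 1 ->
  (* R_{g0} >= 0 *)
  (forall r, inI rho r -> 0 <= scal_conf (df 0%nat) (df 1%nat) (df 2%nat) 0 0 0 r) ->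
  (* k_{g0} <= 0 on both boundary circles *)
  geod_conf 1 (df 0%nat) (df 1%nat) 0 0 rho <= 0 ->
  geod_conf (-1) (df 0%nat) (df 1%nat) 0 0 (- rho) <= 0 ->
  (* reflection symmetry r |-> -r *)
  (forall r, inI rho r -> df 0%nat (- r) = df 0%nat r) ->
  (* scalar curvature decreasing from the middle *)
  (forall r s, inI rho r -> inI rho s -> Rabs r <= Rabs s ->
     scal_conf (df 0%nat) (df 1%nat) (df 2%nat) 0 0 0 s
     <= scal_conf (df 0%nat) (df 1%nat) (df 2%nat) 0 0 0 r) ->
  (* g(t) = e^{2 u(t,r)} g0 is the normalised flow starting at g0 *)
  Du 0%nat 0%nat = u ->
  smooth2_pos Du ->
  (forall r, inI rho r -> u 0 r = 0) ->
  (forall r, inI rho r -> forall eps, 0 < eps -> exists delta, 0 < delta /\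
     forall t x, 0 <= t < delta -> Rabs (x - r) < delta -> inI rho x ->
       Rabs (u t x) < eps) ->
  (* A_{g(t)}(M) = 1 *)
  (forall t, 0 < t ->
     is_integral (fun x => 2 * PI * exp (2 * u t x) * df 0%nat x) (- rho) rho 1) ->
  (* rbar t = int_M R dA_{g(t)} *)
  (forall t, 0 < t ->
     is_integral (fun x =>
        2 * PI * scal_conf (df 0%nat) (df 1%nat) (df 2%nat)
                   (u t x) (Du 0%nat 1%nat t x) (Du 0%nat 2%nat t x) x
        * exp (2 * u t x) * df 0%nat x) (- rho) rho (rbar t)) ->
  (* d/dt g = (rbar - R) g *)
  (forall t r, 0 < t -> inI rho r ->
     2 * Du 1%nat 0%nat t r =
       rbar t - scal_conf (df 0%nat) (df 1%nat) (df 2%nat)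
                  (u t r) (Du 0%nat 1%nat t r) (Du 0%nat 2%nat t r) r) ->
  (* phi(t) = exp (int_0^t rbar): phi(0) = 1, phi' = rbar phi *)
  phi 0 = 1 ->
  (forall eps, 0 < eps -> exists delta, 0 < delta /\
     forall t, 0 < t < delta -> Rabs (phi t - 1) < eps) ->
  (forall t, 0 < t -> 0 < phi t /\ derivable_pt_lim phi t (rbar t * phi t)) ->
  (* boundary condition k_{g(t)} = k_{g0} / sqrt phi *)
  (forall t, 0 < t ->
     geod_conf 1 (df 0%nat) (df 1%nat) (u t rho) (Du 0%nat 1%nat t rho) rho
       = geod_conf 1 (df 0%nat) (df 1%nat) 0 0 rho / sqrt (phi t) /\
     geod_conf (-1) (df 0%nat) (df 1%nat) (u t (- rho)) (Du 0%nat 1%nat t (- rho)) (- rho)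
       = geod_conf (-1) (df 0%nat) (df 1%nat) 0 0 (- rho) / sqrt (phi t)) ->
  (* conclusion: t_k -> oo and max_M R(., t_k) -> 0 *)
  exists tk : nat -> R,
    (forall M, exists N, forall k, (N <= k)%nat -> M < tk k) /\
    (forall eps, 0 < eps -> exists N, forall k, (N <= k)%nat ->
       (forall r, inI rho r ->
          scal_conf (df 0%nat) (df 1%nat) (df 2%nat)
            (u (tk k) r) (Du 0%nat 1%nat (tk k) r) (Du 0%nat 2%nat (tk k) r) r <= eps) /\
       (exists r, inI rho r /\
          - eps <= scal_conf (df 0%nat) (df 1%nat) (df 2%nat)
            (u (tk k) r) (Du 0%nat 1%nat (tk k) r) (Du 0%nat 2%nat (tk k) r) r)).

Proof.
intros rho_pos df_smooth f_pos _ R0_nonneg k0_right _ f_even R0_decr Du_u Du_smooth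
  u_init u_init_cont area rbar_integral flow phi_0 phi_cont_0 phi_ode boundary.
(* A time beyond [n] with tolerance [1 / (n + 1)] gives both limits at once; the point where [R] is
   at least minus the tolerance bounds the maximum from below. *)
assert (small : forall n : nat, exists t, INR n < t /\
          (forall r, inI rho r -> Rscal df u Du t r <= / (INR n + 1)) /\
          exists r, inI rho r /\ - / (INR n + 1) <= Rscal df u Du t r).
{ intros n. apply curvature_small_at_some_time with rbar phi; try assumption.
  apply Rinv_0_lt_compat. assert (h := pos_INR n). lra. }
set (tk := fun n => proj1_sig (constructive_indefinite_description _ (small n))).
assert (Htk : forall n, INR n < tk n /\
          (forall r, inI rho r -> Rscal df u Du (tk n) r <= / (INR n + 1)) /\
          exists r, inI rho r /\ - / (INR n + 1) <= Rscal df u Du (tk n) r)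
  by (intros n; exact (proj2_sig (constructive_indefinite_description _ (small n)))).
exists tk; split.
- intros M. destruct (INR_unbounded M) as [N HN]. exists N. intros k hk.
  apply le_INR in hk. destruct (Htk k) as [h _]. lra.
- intros eps he. destruct (INR_unbounded (/ eps)) as [N HN]. exists N. intros k hk.
  apply le_INR in hk. destruct (Htk k) as [_ [h1 [r [hr h2]]]].
  assert (le : / (INR k + 1) <= eps).
  { rewrite <- (Rinv_inv eps). apply Rinv_le_contravar; [|lra].
    apply Rinv_0_lt_compat, he. }
  split.
  + intros x hx. specialize (h1 x hx). unfold Rscal in h1. lra.
  + exists r; split; [exact hr|]. unfold Rscal in h2. lra.
Qed.
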